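(* Let $p$ be a prime and $B_p$ the quaternion algebra over $\mathbb{Q}$ ramified exactly at $p$ and $\infty$. If $\mathcal{O},\mathcal{O}'$ are maximal orders in $B_p$ with $\theta_{\mathcal{O}}=\theta_{\mathcal{O}'}$, then $\mathcal{O}\simeq\mathcal{O}'$ (as rings).
   Context: $N(x)=x\overline{x}$ denotes the reduced norm on $B_p$, with $\overline{x}$ the canonical involution. For a lattice $\Lambda$ with integral quadratic form $Q$, its theta function is the formal power series $\theta_\Lambda(q)=\sum_{x\in\Lambda}q^{Q(x)}$. For an order $\mathcal{O}\subseteq B_p$, the quadratic form is the norm $N$, so the coefficient of $q^n$ in $\theta_{\mathcal{O}}$ is the number of elements of $\mathcal{O}$ of norm $n$. *)

(* Defs.v *)
From HB Require Import structures.
From mathcomp Require Import all_boot all_order all_algebra.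
Set Implicit Arguments. Unset Strict Implicit. Unset Printing Implicit Defensive.
Import Order.TTheory GRing.Theory Num.Theory.
Local Open Scope ring_scope.

(** * Quaternion algebras H(a,b) over Q, a b nonzero integers.
    Elements are coordinate rows x = x0 + x1 i + x2 j + x3 k with
    i^2 = a, j^2 = b, ij = -ji = k. *)

Definition quat := 'rV[rat]_4.

Definition qc (x : quat) (n : nat) : rat := x ord0 (inord n).

Definition qmk (c0 c1 c2 c3 : rat) : quat :=
  \row_(m < 4) nth 0 [:: c0; c1; c2; c3] m.

Definition qone : quat := qmk 1 0 0 0.

Definition qmul (a b : int) (x y : quat) : quat :=
  let A : rat := a%:~R in let B : rat := b%:~R in
  qmk (qc x 0 * qc y 0 + A * qc x 1 * qc y 1 + B * qc x 2 * qc y 2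
         - A * B * qc x 3 * qc y 3)
      (qc x 0 * qc y 1 + qc x 1 * qc y 0 - B * qc x 2 * qc y 3
         + B * qc x 3 * qc y 2)
      (qc x 0 * qc y 2 + qc x 2 * qc y 0 + A * qc x 1 * qc y 3
         - A * qc x 3 * qc y 1)
      (qc x 0 * qc y 3 + qc x 3 * qc y 0 + qc x 1 * qc y 2
         - qc x 2 * qc y 1).

Definition qconj (x : quat) : quat := qmk (qc x 0) (- qc x 1) (- qc x 2) (- qc x 3).

(** reduced norm N(x) = x * conj x (a scalar; we take its rational coordinate) *)
Definition qnorm (a b : int) (x : quat) : rat := qc (qmul a b x (qconj x)) 0.

(** * Ramification of H(a,b).
    At a finite prime l: H(a,b) splits at l iff a X^2 + b Y^2 = Z^2 has a
    nontrivial solution in Q_l, i.e. (by compactness of primitive vectors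
    of Z_l^3) iff for every k it has a primitive solution modulo l^k. *)
Definition splits_at (l : nat) (a b : int) : Prop :=
  forall k : nat, exists x y z : int,
    ~~ [&& (l%:Z %| x)%Z, (l%:Z %| y)%Z & (l%:Z %| z)%Z] /\
    ((l%:Z ^+ k) %| a * x ^+ 2 + b * y ^+ 2 - z ^+ 2)%Z.

Definition ramified_at (l : nat) (a b : int) : Prop := ~ splits_at l a b.

Definition ramified_at_infty (a b : int) : Prop := a < 0 /\ b < 0.

Definition ramified_exactly_at_p_infty (p : nat) (a b : int) : Prop :=
  a != 0 /\ b != 0 /\ ramified_at_infty a b /\
  (forall l : nat, prime l -> (ramified_at l a b <-> l = p)).

Definition qset := quat -> Prop.

Definition lattice_of (E : 'M[rat]_4) : qset :=
  fun x => exists u : 'rV[int]_4, x = map_mx (fun n : int => n%:~R) u *m E.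

Definition is_order (a b : int) (O : qset) : Prop :=
  (exists E : 'M[rat]_4, E \in unitmx /\ forall x, O x <-> lattice_of E x) /\
  O qone /\ (forall x y, O x -> O y -> O (qmul a b x y)).

Definition is_maximal_order (a b : int) (O : qset) : Prop :=
  is_order a b O /\
  forall O', is_order a b O' -> (forall x, O x -> O' x) -> forall x, O' x -> O x.

(** theta_O = theta_O' : for each n, the sets of elements of norm n
    have the same cardinality (coefficientwise equality) *)
Definition same_theta (a b : int) (O O' : qset) : Prop :=
  forall n : nat,
    exists f : {x : quat | O x /\ qnorm a b x = n%:R} ->
               {x : quat | O' x /\ qnorm a b x = n%:R}, bijective f.

Definition ring_isomorphic (a b : int) (O O' : qset) : Prop :=
  exists f : quat -> quat,
    (forall x, O x -> O' (f x)) /\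
    (forall y, O' y -> exists x, O x /\ f x = y) /\
    (forall x y, O x -> O y -> f x = f y -> x = y) /\
    f qone = qone /\
    (forall x y, O x -> O y -> f (x + y) = f x + f y) /\
    (forall x y, O x -> O y -> f (qmul a b x y) = qmul a b (f x) (f y)).

(* Main.v *)
Require Import Defs.
From mathcomp Require Import all_boot all_order all_algebra.
From mathcomp Require Import ring zify.
From Stdlib Require Import Classical ClassicalEpsilon.
Set Implicit Arguments. Unset Strict Implicit. Unset Printing Implicit Defensive.
Import Order.TTheory GRing.Theory Num.Theory.
Local Open Scope ring_scope.

(** A quaternion order is the even Clifford algebra of an integral ternary form
    F = a x^2 + b y^2 + c z^2 + u y z + v x z + w x y, and four times its norm is
    (2t + ux + vy + wz)^2 + D(x, y, z), where D is the form of the Gross lattice, i.e.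
    the adjoint of F.  For a maximal order in the algebra ramified at p and infinity,
    F has half-discriminant p: at a prime l dividing the discriminant, either F
    shows a proper overorder, or F is anisotropic at l and l divides the discriminant
    exactly once, and then the algebra does not split at l.

    Two independent vectors of D-norm M span a plane of determinant divisible by 4p, which
    forces M > p.  Hence every 0 < M <= p has 0 or 2 representations by D.  The coefficient of
    q^n in theta is the sum over t of r_D(4n - t^2), and the new terms r_D(4n) +
    2 r_D(4n - 1) take the distinct values 0, 2, 4, 6, so theta determines which M <= p
    are represented by D.  Reduce D, with successive minima D1 <= D2 <= D3, and let
    c = (D1 D2 - s12^2)/4p.  If c > 1 then D3 < p; the minima are determined, and then the
    entries s_ij, because s_ij^2 = D_i D_j mod p.  If c = 1 the plane spanned by the first
    two minimal vectors determines F, and D1, D2 are determined as well. *)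

(** * Quaternions *)

(** The obstacle is that theta controls [D] only up to [p], where a represented number comes from a
    single pair of opposite vectors. In a reduced basis the third vector has squared distance [p/c]
    to the plane of the first two, and its projection to that plane has squared length at most
    [(D1 + D2)/4]. A third minimum out of reach therefore forces [c = 1]; and [c] is the coefficient
    of [z^2] in [F], so that shears then normalise all that involves the third variable.

    Equivalence of forms is never defined. A predicate is [stable] when generators of GL3(Z)
    preserve it, and the predicate used at the end is being a form of the second order: once it
    passes from [G] to [F], both orders have the same multiplication table.

    No completion at [l] is formed either. Anisotropy means that [l^2 | N(x)] puts [x] in [l O]; by
    iteration, norms divisible by [l^(2m)] come from [l^m O] only, which excludes primitive
    solutions modulo [l^(2m)] for large [m]. *)

Lemma quat_eqP (x y : quat) : qc x 0 = qc y 0 -> qc x 1 = qc y 1 ->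
  qc x 2 = qc y 2 -> qc x 3 = qc y 3 -> x = y.
Proof.
move=> h0 h1 h2 h3; apply/rowP => i; rewrite -[i]inord_val.
by case: i => [[|[|[|[|//]]]] hi].
Qed.

Lemma qc_mk (c0 c1 c2 c3 : rat) (n : nat) : (n < 4)%N ->
  qc (qmk c0 c1 c2 c3) n = nth 0 [:: c0; c1; c2; c3] n.
Proof. by move=> hn; rewrite /qc /qmk mxE inordK. Qed.

Lemma qc_add (x y : quat) n : qc (x + y) n = qc x n + qc y n.
Proof. by rewrite /qc mxE. Qed.
Lemma qc_opp (x : quat) n : qc (- x) n = - qc x n.
Proof. by rewrite /qc mxE. Qed.
Lemma qc_scale (k : rat) (x : quat) n : qc (k *: x) n = k * qc x n.
Proof. by rewrite /qc mxE. Qed.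
Lemma qc_zero n : qc 0 n = 0.
Proof. by rewrite /qc mxE. Qed.

Definition qcE := (qc_add, qc_opp, qc_scale, qc_zero, qc_mk).

Definition qtr (x : quat) : rat := 2 * qc x 0.

Ltac qexpand := rewrite /qnorm /qtr /qmul /qconj /qone ?qcE //=.
Ltac qring := apply: quat_eqP; qexpand; ring.

Lemma qmulDl a b (x y z : quat) : qmul a b (x + y) z = qmul a b x z + qmul a b y z.
Proof. qring. Qed.
Lemma qmulDr a b (x y z : quat) : qmul a b x (y + z) = qmul a b x y + qmul a b x z.
Proof. qring. Qed.
Lemma qmulZl a b k (x y : quat) : qmul a b (k *: x) y = k *: qmul a b x y.
Proof. qring. Qed.
Lemma qmulZr a b k (x y : quat) : qmul a b x (k *: y) = k *: qmul a b x y.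
Proof. qring. Qed.
Lemma qmulNl a b (x y : quat) : qmul a b (- x) y = - qmul a b x y.
Proof. qring. Qed.
Lemma qmulNr a b (x y : quat) : qmul a b x (- y) = - qmul a b x y.
Proof. qring. Qed.
Lemma qmul1l a b (x : quat) : qmul a b qone x = x.
Proof. qring. Qed.
Lemma qmul1r a b (x : quat) : qmul a b x qone = x.
Proof. qring. Qed.
Definition qmul_lin := (qmulDl, qmulDr, qmulZl, qmulZr, qmulNl, qmulNr, qmul1l, qmul1r).

Lemma qmulA a b (x y z : quat) : qmul a b x (qmul a b y z) = qmul a b (qmul a b x y) z.
Proof. qring. Qed.
Lemma qconjK (x : quat) : qconj (qconj x) = x.
Proof. qring. Qed.
Lemma qconjM a b (x y : quat) : qconj (qmul a b x y) = qmul a b (qconj y) (qconj x).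
Proof. qring. Qed.
Lemma qconjE (x : quat) : qconj x = qtr x *: qone - x.
Proof. qring. Qed.
Lemma qconjZ k (x : quat) : qconj (k *: x) = k *: qconj x.
Proof. qring. Qed.
Lemma qmul_conj a b (x : quat) : qmul a b x (qconj x) = qnorm a b x *: qone.
Proof. qring. Qed.
Lemma qconj_mul a b (x : quat) : qmul a b (qconj x) x = qnorm a b x *: qone.
Proof. qring. Qed.
Lemma qnormM a b (x y : quat) : qnorm a b (qmul a b x y) = qnorm a b x * qnorm a b y.
Proof. qexpand; ring. Qed.
Lemma qnorm_conj a b (x : quat) : qnorm a b (qconj x) = qnorm a b x.
Proof. qexpand; ring. Qed.
Lemma qnormZ a b k (x : quat) : qnorm a b (k *: x) = k ^+ 2 * qnorm a b x.
Proof. qexpand; ring. Qed.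
Lemma qnorm1 a b : qnorm a b qone = 1.
Proof. qexpand; ring. Qed.
Lemma qsqr a b (x : quat) : qmul a b x x = qtr x *: x - qnorm a b x *: qone.
Proof. qring. Qed.
Lemma qmul_swap a b (x y : quat) : qmul a b y x =
  - qmul a b x y + qtr x *: y + qtr y *: x
    + (qtr (qmul a b x y) - qtr x * qtr y) *: qone.
Proof. qring. Qed.
Lemma qtrD (x y : quat) : qtr (x + y) = qtr x + qtr y.
Proof. qexpand; ring. Qed.
Lemma qtrZ k (x : quat) : qtr (k *: x) = k * qtr x.
Proof. qexpand; ring. Qed.
Lemma qtr1 : qtr qone = 2.
Proof. qexpand; ring. Qed.
Lemma qtr_conj (x : quat) : qtr (qconj x) = qtr x.
Proof. qexpand; ring. Qed.
Lemma qnormD a b (x y : quat) : qnorm a b (x + y) =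
  qnorm a b x + qnorm a b y + (qtr x * qtr y - qtr (qmul a b x y)).
Proof. qexpand; ring. Qed.

Lemma qnormE a b (x : quat) : qnorm a b x =
  qc x 0 ^+ 2 + (- a%:~R) * qc x 1 ^+ 2 + (- b%:~R) * qc x 2 ^+ 2
  + (- a%:~R) * (- b%:~R) * qc x 3 ^+ 2.
Proof. qexpand; ring. Qed.

Lemma qnorm_ge0 (a b : int) (x : quat) : a < 0 -> b < 0 -> 0 <= qnorm a b x.
Proof.
move=> ha hb; have hA : 0 <= - (a%:~R : rat) by rewrite oppr_ge0 lerz0 ltW.
have hB : 0 <= - (b%:~R : rat) by rewrite oppr_ge0 lerz0 ltW.
have hAB := mulr_ge0 hA hB.
by rewrite qnormE !addr_ge0 ?sqr_ge0 // mulr_ge0 ?sqr_ge0.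
Qed.

Lemma qnorm_eq0 (a b : int) (x : quat) : a < 0 -> b < 0 -> qnorm a b x = 0 -> x = 0.
Proof.
move=> ha hb; have hA : 0 < - (a%:~R : rat) by rewrite oppr_gt0 ltrz0.
have hB : 0 < - (b%:~R : rat) by rewrite oppr_gt0 ltrz0.
have hAB := mulr_gt0 hA hB.
rewrite qnormE => /eqP.
have p0 := sqr_ge0 (qc x 0).
have p1 := mulr_ge0 (ltW hA) (sqr_ge0 (qc x 1)).
have p2 := mulr_ge0 (ltW hB) (sqr_ge0 (qc x 2)).
have p3 := mulr_ge0 (ltW hAB) (sqr_ge0 (qc x 3)).
rewrite !paddr_eq0 ?addr_ge0 // !mulf_eq0 !(gt_eqF hA) !(gt_eqF hB) /= !orbb.
by move=> /andP[/andP[/andP[/eqP e0 /eqP e1] /eqP e2] /eqP e3]; apply: quat_eqP; rewrite qc_zero.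
Qed.

Lemma qnorm_gt0 (a b : int) (x : quat) : a < 0 -> b < 0 -> x != 0 -> 0 < qnorm a b x.
Proof.
move=> ha hb hx; rewrite lt_def qnorm_ge0 // andbT.
by apply: contra hx => /eqP /qnorm_eq0 ->.
Qed.

(** * Ternary forms *)

Record tform := Form {fa : int; fb : int; fc : int; fu : int; fv : int; fw : int}.

Definition disc F := 4 * fa F * fb F * fc F + fu F * fv F * fw F
  - fa F * fu F ^+ 2 - fb F * fv F ^+ 2 - fc F * fw F ^+ 2.
Definition D1 F := 4 * fb F * fc F - fu F ^+ 2.
Definition D2 F := 4 * fa F * fc F - fv F ^+ 2.
Definition D3 F := 4 * fa F * fb F - fw F ^+ 2.
Definition s12 F := fu F * fv F - 2 * fc F * fw F.
Definition s13 F := fu F * fw F - 2 * fb F * fv F.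
Definition s23 F := fv F * fw F - 2 * fa F * fu F.

Definition Dv F (x y z : int) : int := D1 F * x ^+ 2 + D2 F * y ^+ 2 + D3 F * z ^+ 2
  + 2 * (s12 F * x * y + s13 F * x * z + s23 F * y * z).

Definition posdef F := [/\ 0 < fa F, 0 < D3 F & 0 < disc F].

Ltac fring := rewrite /Dv /D1 /D2 /D3 /s12 /s13 /s23 /disc /=; ring.

Lemma minor12 F : D1 F * D2 F - s12 F ^+ 2 = 4 * disc F * fc F. Proof. fring. Qed.
Lemma minor13 F : D1 F * D3 F - s13 F ^+ 2 = 4 * disc F * fb F. Proof. fring. Qed.
Lemma minor23 F : D2 F * D3 F - s23 F ^+ 2 = 4 * disc F * fa F. Proof. fring. Qed.
Lemma detD F : D1 F * D2 F * D3 F + 2 * (s12 F * s13 F * s23 F)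
  - D1 F * s23 F ^+ 2 - D2 F * s13 F ^+ 2 - D3 F * s12 F ^+ 2 = 4 * disc F ^+ 2.
Proof. fring. Qed.

Lemma posdef_all F : posdef F ->
  [/\ 0 < fa F, 0 < fb F, 0 < fc F & [/\ 0 < D1 F, 0 < D2 F, 0 < D3 F & 0 < disc F]].
Proof.
move=> [ha h3 hd].
have hb : 0 < fb F by move: h3 ha; rewrite /D3; nia.
have hm := minor23 F; have hm' := minor13 F.
have h2 : 0 < D2 F.
  have : 0 < disc F * fa F by rewrite mulr_gt0.
  by move: hm h3; clear; nia.
have h1 : 0 < D1 F.
  have : 0 < disc F * fb F by rewrite mulr_gt0.
  by move: hm' h3; clear; nia.
have hc : 0 < fc F by move: h2 ha; rewrite /D2; clear; nia.
by split => //; split.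
Qed.

(** Two completions of the square: clearing [z] leaves [4 * disc F] times the binary form with
    coefficients [fb], [- fw], [fa], and [D3] is its determinant up to a factor. Definiteness of [D]
    and the bound on coordinates are read off from this. *)
Lemma Dv_sq F (x y z : int) : D3 F * fa F * Dv F x y z =
  fa F * (D3 F * z + s23 F * y + s13 F * x) ^+ 2 +
  disc F * ((2 * fa F * y - fw F * x) ^+ 2 + D3 F * x ^+ 2).
Proof. fring. Qed.

Lemma Dv_mod4 F (x y z : int) : exists q : int, Dv F x y z = 4 * q - (fu F * x + fv F * y + fw F * z) ^+ 2.
Proof.
exists (fb F * fc F * x ^+ 2 + fa F * fc F * y ^+ 2 + fa F * fb F * z ^+ 2
  + (fu F * fv F - fc F * fw F) * x * y + (fu F * fw F - fb F * fv F) * x * z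
  + (fv F * fw F - fa F * fu F) * y * z).
fring.
Qed.

Lemma Dv_mod4_cases F (x y z : int) : exists q : int, Dv F x y z = 4 * q \/ Dv F x y z = 4 * q + 3.
Proof.
have [q ->] := Dv_mod4 F x y z; set l := (X in X ^+ 2).
have [h|h] : (exists m, l = 2 * m) \/ (exists m, l = 2 * m + 1).
- by have := divz_eq l 2; have := modz_ge0 l (isT : 2 != 0 :> int);
    have := ltz_pmod l (isT : 0 < 2 :> int); move=> h1 h2 h3;
    case: (eqVneq (l %% 2)%Z 0) => h; [left|right]; exists (l %/ 2)%Z; lia.
- by case: h => m ->; exists (q - m ^+ 2); left; ring.
- by case: h => m ->; exists (q - m ^+ 2 - m - 1); right; ring.
Qed.

Lemma Dv_ge0 F (x y z : int) : posdef F -> 0 <= Dv F x y z.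
Proof.
move=> /posdef_all [ha _ _ [_ _ h3 hd]].
rewrite -(pmulr_rge0 _ (mulr_gt0 h3 ha)) Dv_sq.
apply: addr_ge0; apply: mulr_ge0; rewrite ?(ltW ha) ?(ltW hd) ?sqr_ge0 //.
by apply: addr_ge0; rewrite ?sqr_ge0 // mulr_ge0 ?sqr_ge0 // ltW.
Qed.

Lemma Dv_eq0 F (x y z : int) : posdef F -> Dv F x y z = 0 -> [/\ x = 0, y = 0 & z = 0].
Proof.
move=> /posdef_all [ha _ _ [_ _ h3 hd]] h0.
have := Dv_sq F x y z; rewrite h0 mulr0 => /esym/eqP.
have p1 := mulr_ge0 (ltW h3) (sqr_ge0 x).
have p2 := addr_ge0 (sqr_ge0 (2 * fa F * y - fw F * x)) p1.
rewrite paddr_eq0 ?(mulr_ge0 (ltW ha) (sqr_ge0 _)) ?(mulr_ge0 (ltW hd) p2) //.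
rewrite !(mulf_eq0 (fa F)) !(mulf_eq0 (disc F)) (gt_eqF ha) (gt_eqF hd) !orFb.
rewrite (paddr_eq0 (sqr_ge0 _) p1) (mulf_eq0 (D3 F)) (gt_eqF h3) !sqrf_eq0 orFb.
move=> /and3P[/eqP ez /eqP ey /eqP ex].
have ey0 : y = 0 by move: ey ha; rewrite ex; clear; nia.
by split => //; move: ez h3; rewrite ex ey0; clear; nia.
Qed.

Lemma Dv_gt0 F (x y z : int) : posdef F -> [|| x != 0, y != 0 | z != 0] -> 0 < Dv F x y z.
Proof.
move=> hF h; rewrite lt_def Dv_ge0 // andbT.
by apply: contraTN h => /eqP /(Dv_eq0 hF)[-> -> ->].
Qed.

Lemma Dv_bound F (x y z : int) : posdef F -> x ^+ 2 <= fa F * Dv F x y z.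
Proof.
move=> /posdef_all [ha _ _ [_ _ h3 hd]].
rewrite -(ler_pM2l h3) [D3 F * (fa F * _)]mulrA Dv_sq.
have p1 := mulr_ge0 (ltW ha) (sqr_ge0 (D3 F * z + s23 F * y + s13 F * x)).
have p2 := mulr_ge0 (ltW hd) (sqr_ge0 (2 * fa F * y - fw F * x)).
have p3 : D3 F * x ^+ 2 <= disc F * (D3 F * x ^+ 2).
  by rewrite ler_peMl // mulr_ge0 ?sqr_ge0 // ltW.
by rewrite mulrDr; lia.
Qed.

Lemma DvN F (x y z : int) : Dv F (- x) (- y) (- z) = Dv F x y z. Proof. fring. Qed.

Lemma Dv_ge3 F (x y z : int) : posdef F -> [|| x != 0, y != 0 | z != 0] -> 3 <= Dv F x y z.
Proof.
move=> hF h; have := Dv_gt0 hF h; have [q [|] ->] := Dv_mod4_cases F x y z; lia.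
Qed.

Definition Bv F x y z x' y' z' := D1 F * x * x' + D2 F * y * y' + D3 F * z * z'
  + s12 F * (x * y' + x' * y) + s13 F * (x * z' + x' * z) + s23 F * (y * z' + y' * z).
Definition Fv F x y z := fa F * x ^+ 2 + fb F * y ^+ 2 + fc F * z ^+ 2
  + fu F * y * z + fv F * x * z + fw F * x * y.

Lemma Dv_polar F x y z x' y' z' :
  Dv F (x + x') (y + y') (z + z') = Dv F x y z + Dv F x' y' z' + 2 * Bv F x y z x' y' z'.
Proof. rewrite /Bv; fring. Qed.

Lemma Dv_polarN F x y z x' y' z' :
  Dv F (x - x') (y - y') (z - z') = Dv F x y z + Dv F x' y' z' - 2 * Bv F x y z x' y' z'.
Proof. rewrite /Bv; fring. Qed.

(** [D] is the adjoint of [F], so the Gram determinant of two vectors is [4 * disc F] times the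
    value of [F] at their cross product. *)
Lemma Dv_lagrange F x y z x' y' z' :
  Dv F x y z * Dv F x' y' z' - Bv F x y z x' y' z' ^+ 2 =
  4 * disc F * Fv F (y * z' - z * y') (z * x' - x * z') (x * y' - y * x').
Proof. rewrite /Bv /Fv; fring. Qed.

(* Two independent vectors of norm M span a sublattice of determinant
   M^2 - s^2, which is divisible by 4p, so p divides one of (M - s)/2, (M + s)/2. *)
Lemma Dv_distinct F (p : nat) x y z x' y' z' : posdef F -> disc F = p -> prime p ->
  Dv F x y z = Dv F x' y' z' -> Dv F x y z <= p ->
  (x, y, z) = (x', y', z') \/ (x, y, z) = (- x', - y', - z').
Proof.
move=> hF hd hp hM hle; set M := Dv F x y z in hM hle *.
set s := Bv F x y z x' y' z'.
have hm := Dv_polarN F x y z x' y' z'; rewrite -/M -hM -/s in hm.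
have hpl := Dv_polar F x y z x' y' z'; rewrite -/M -hM -/s in hpl.
have hL := Dv_lagrange F x y z x' y' z'; rewrite -/M -hM -/s hd in hL.
case: (eqVneq (Dv F (x - x') (y - y') (z - z')) 0) => [/(Dv_eq0 hF)[ex ey ez]|n1].
  left; congr (_, _, _); lia.
case: (eqVneq (Dv F (x + x') (y + y') (z + z')) 0) => [/(Dv_eq0 hF)[ex ey ez]|n2].
  right; congr (_, _, _); lia.
have g1 : 0 < Dv F (x - x') (y - y') (z - z') by rewrite lt_def n1 Dv_ge0.
have g2 : 0 < Dv F (x + x') (y + y') (z + z') by rewrite lt_def n2 Dv_ge0.
have [q1 hq1] := Dv_mod4_cases F (x - x') (y - y') (z - z').
have [q2 hq2] := Dv_mod4_cases F (x + x') (y + y') (z + z').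
rewrite hm in g1 hq1; rewrite hpl in g2 hq2; exfalso.
set X := Fv _ _ _ _ in hL.
(* [2 (M - s)] and [2 (M + s)] are even values of [D], which are 0 or 3 modulo 4, hence multiples of
   4. So [q1] and [q2] are positive with sum [M <= p], and neither is a multiple of [p]. *)
have e1 : M - s = 2 * q1 by lia.
have e2 : M + s = 2 * q2 by lia.
have eX : q1 * q2 = p%:Z * X by move: hL e1 e2; clear; nia.
have : (p %| absz q1 * absz q2)%N by rewrite -abszM eX abszM absz_nat dvdn_mulr.
rewrite Euclid_dvdM // => /orP[] /dvdn_leq; lia.
Qed.

(** * Changes of basis and predicates invariant under them *)

Definition rot F := Form (fb F) (fc F) (fa F) (fv F) (fw F) (fu F).
Definition swp F := Form (fb F) (fa F) (fc F) (fv F) (fu F) (fw F).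
Definition neg1 F := Form (fa F) (fb F) (fc F) (fu F) (- fv F) (- fw F).
Definition shear m F := Form (fa F + m * fw F + m ^+ 2 * fb F) (fb F) (fc F) (fu F)
  (fv F + m * fu F) (fw F + 2 * m * fb F).

(** The four operations generate the action of GL3(Z), so a stable predicate is a union of
    equivalence classes of forms. *)
Definition stable (P : tform -> Prop) :=
  [/\ forall F, P F -> P (rot F), forall F, P F -> P (swp F),
      forall F, P F -> P (neg1 F) & forall m F, P F -> P (shear m F)].

Definition swp23 F := rot (swp F).
Definition swp13 F := swp (rot F).
Definition neg2 F := swp (neg1 (swp F)).
Definition neg3 F := swp13 (neg1 (swp13 F)).
(** Named after the effect on [D], which transforms contragrediently to [F]: the third vector of the
    Gross lattice gains [m] times the first. *)
Definition shear31 m F := swp23 (shear (- m) (swp23 F)).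
Definition shear32 m F := swp (shear31 m (swp F)).

Section Stable.
Variable (P : tform -> Prop).
Hypothesis hP : stable P.
Lemma stable_swp F : P F -> P (swp F). Proof. by case: hP => ? h ? ?; apply: h. Qed.
Lemma stable_rot F : P F -> P (rot F). Proof. by case: hP => h ? ? ?; apply: h. Qed.
Lemma stable_neg1 F : P F -> P (neg1 F). Proof. by case: hP => ? ? h ?; apply: h. Qed.
Lemma stable_shear m F : P F -> P (shear m F). Proof. by case: hP => ? ? ? h; apply: h. Qed.
Lemma stable_swp23 F : P F -> P (swp23 F).
Proof. by move=> h; apply/stable_rot/stable_swp. Qed.
Lemma stable_swp13 F : P F -> P (swp13 F).
Proof. by move=> h; apply/stable_swp/stable_rot. Qed.
Lemma stable_neg2 F : P F -> P (neg2 F).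
Proof. by move=> h; apply/stable_swp/stable_neg1/stable_swp. Qed.
Lemma stable_neg3 F : P F -> P (neg3 F).
Proof. by move=> h; apply/stable_swp13/stable_neg1/stable_swp13. Qed.
Lemma stable_shear31 m F : P F -> P (shear31 m F).
Proof. by move=> h; apply/stable_swp23/stable_shear/stable_swp23. Qed.
Lemma stable_shear32 m F : P F -> P (shear32 m F).
Proof. by move=> h; apply/stable_swp/stable_shear31/stable_swp. Qed.
End Stable.

(** * Reduction theory of the Gross lattice *)

Definition trD F := D1 F + D2 F + D3 F.

Record reduced F : Prop := Reduced {
  red12 : D1 F <= D2 F;
  red23 : D2 F <= D3 F;
  red_x2 : forall m, D2 F <= Dv F m 1 0;
  red_x3 : forall m n, D3 F <= Dv F m n 1 }.

Lemma trD_swp F : trD (swp F) = trD F. Proof. rewrite /trD; fring. Qed.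
Lemma trD_swp23 F : trD (swp23 F) = trD F. Proof. rewrite /trD; fring. Qed.

Lemma exists_trD_min (P : tform -> Prop) F0 : P F0 -> (forall F, P F -> posdef F) ->
  exists2 F, P F & forall G, P G -> trD F <= trD G.
Proof.
move=> h0 hpos.
have hn : forall F, P F -> 0 <= trD F.
  by move=> F /hpos /posdef_all [_ _ _ [h1 h2 h3 _]]; rewrite /trD; lia.
suff H n F : P F -> (absz (trD F) <= n)%N -> exists2 F, P F & forall G, P G -> trD F <= trD G.
  by apply: (H `|trD F0|%N F0).
elim: n F => [|n IH] F hF hle.
  by exists F => // G hG; have := hn _ hG; have := hn _ hF; lia.
case: (classic (exists2 G, P G & trD G < trD F)) => [[G hG hlt]|hno].
  by apply: (IH G) => //; have := hn _ hG; have := hn _ hF; lia.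
exists F => // G hG; rewrite leNgt; apply/negP => hlt; apply: hno; by exists G.
Qed.

(** A shear changes a single diagonal entry of [D], so a form of least trace satisfies all the
    inequalities; sorting the diagonal keeps the trace. *)
Lemma exists_reduced (P : tform -> Prop) F0 : stable P -> P F0 ->
  (forall F, P F -> posdef F) -> exists2 F, P F & reduced F.
Proof.
move=> hP h0 hpos; have [F hF hmin] := exists_trD_min h0 hpos.
have [G hG [g12 g23 gtr]] : exists2 G, P G & [/\ D1 G <= D2 G, D2 G <= D3 G & trD G = trD F].
  have sw H : [/\ D1 (swp H) = D2 H, D2 (swp H) = D1 H & D3 (swp H) = D3 H].
    by split; fring.
  have sw' H : [/\ D1 (swp23 H) = D1 H, D2 (swp23 H) = D3 H & D3 (swp23 H) = D2 H].
    by split; fring.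
  have [G hG [g12 gtr]] : exists2 G, P G & D1 G <= D2 G /\ trD G = trD F.
    case: (leP (D1 F) (D2 F)) => h; first by exists F.
    exists (swp F); first exact: stable_swp.
    by rewrite trD_swp; case: (sw F) => -> -> _; split=> //; apply: ltW.
  case: (leP (D2 G) (D3 G)) => h; first by exists G.
  case: (leP (D1 G) (D3 G)) => h'.
    exists (swp23 G); first exact: stable_swp23.
    by rewrite trD_swp23; case: (sw' G) => -> -> ->; split=> //; apply: ltW.
  exists (swp (swp23 G)); first by apply: stable_swp => //; apply: stable_swp23.
  rewrite trD_swp trD_swp23; case: (sw (swp23 G)) => -> -> ->.
  by case: (sw' G) => -> -> ->; split => //; apply: ltW.
exists G => //; split=> // [m|m n].
  have := hmin _ (stable_shear hP (- m) hG).
  rewrite -gtr /trD (_ : D1 (shear _ _) = D1 G) 1?(_ : D2 (shear _ _) = Dv G m 1 0)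
    1?(_ : D3 (shear _ _) = D3 G); try fring.
  by lia.
have := hmin _ (stable_shear31 hP m (stable_shear32 hP n hG)).
rewrite -gtr /trD; set H := shear31 _ _.
rewrite (_ : D1 H = D1 G) 1?(_ : D2 H = D2 G) 1?(_ : D3 H = Dv G m n 1); try fring.
by lia.
Qed.

Section Reduced.
Variable F : tform.
Hypotheses (hF : posdef F) (hR : reduced F).

Lemma red_s12 : 2 * `|s12 F| <= D1 F.
Proof.
have h1 := red_x2 hR 1; have h2 := red_x2 hR (-1).
by move: h1 h2; rewrite /Dv; case: (lerP 0 (s12 F)); lia.
Qed.

Lemma red_s13 : 2 * `|s13 F| <= D1 F.
Proof.
have h1 := red_x3 hR 1 0; have h2 := red_x3 hR (-1) 0.
by move: h1 h2; rewrite /Dv; case: (lerP 0 (s13 F)); lia.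
Qed.

Lemma red_s23 : 2 * `|s23 F| <= D2 F.
Proof.
have h1 := red_x3 hR 0 1; have h2 := red_x3 hR 0 (-1).
by move: h1 h2; rewrite /Dv; case: (lerP 0 (s23 F)); lia.
Qed.

End Reduced.

(** Let [A], [B], [s] be the Gram data of two vectors and [x], [y] the inner products of a third
    vector with them. The left side is [4 (A B - s^2)] times the squared length of its projection to
    their plane, which is thus at most [(A + B)/4]. This is the case [s x y >= 0]. *)
Lemma seeber_pos (A B s x y : int) : 0 < A -> A <= B -> 0 <= s -> 0 <= x -> 0 <= y ->
  2 * s <= A -> 2 * x <= A -> 2 * y <= B ->
  4 * (A * y ^+ 2 + B * x ^+ 2 - 2 * s * x * y) <= (A + B) * (A * B - s ^+ 2).
Proof.
move=> hA hAB hs hx hy hsA hxA hyB.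
have hB : 0 < B by lia.
have hss : (A + B) * s ^+ 2 <= A * B * s by nia.
have e1 : 4 * (A * y ^+ 2) <= 2 * A * B * y by nia.
have e2 : 4 * (B * x ^+ 2) <= 2 * A * B * x by nia.
set R := (A + B) * (A * B - s ^+ 2).
have r0 : 0 <= R by rewrite /R; nia.
have r1 : 0 <= R - A ^+ 2 * B by rewrite /R; nia.
have r2 : 0 <= R - A * B ^+ 2 by rewrite /R; nia.
have r3 : 0 <= R - (A ^+ 2 * B + A * B ^+ 2 - 2 * s * A * B) by rewrite /R; nia.
have X0 : 0 <= A - 2 * x by lia.
have Y0 : 0 <= B - 2 * y by lia.
(* By [e1] and [e2] it is enough to bound a function that is bilinear in [x], [y] on the rectangle
   [[0, A/2] x [0, B/2]]. The identity below is interpolation from the four corners, where the gaps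
   are [r0] to [r3]. *)
have : 0 <= A * B * (R - (2 * A * B * (x + y) - 8 * s * x * y)).
  rewrite (_ : _ * _ = (A - 2 * x) * (B - 2 * y) * R
     + (2 * x) * (B - 2 * y) * (R - A ^+ 2 * B)
     + (A - 2 * x) * (2 * y) * (R - A * B ^+ 2)
     + (2 * x) * (2 * y) * (R - (A ^+ 2 * B + A * B ^+ 2 - 2 * s * A * B))); last by ring.
  have p : forall a b c : int, 0 <= a -> 0 <= b -> 0 <= c -> 0 <= a * b * c.
    by move=> *; apply: mulr_ge0 => //; apply: mulr_ge0.
  by rewrite !addr_ge0 // p // mulr_ge0.
by rewrite pmulr_rge0 ?mulr_gt0 //; lia.
Qed.

(** The case of a negative product of inner products, with [t], [x], [y] their absolute values. The
    last hypothesis comes from comparing [D3] with [D] at [(±1, ±1, 1)]; it cuts off the corner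
    [(A/2, B/2)], where the inequality fails if [t > 0]. *)
Lemma seeber_neg (A B t x y : int) : 0 < A -> A <= B -> 0 <= t -> 0 <= x -> 0 <= y ->
  2 * t <= A -> 2 * x <= A -> 2 * y <= B -> 2 * (t + x + y) <= A + B ->
  4 * (A * y ^+ 2 + B * x ^+ 2 + 2 * t * x * y) <= (A + B) * (A * B - t ^+ 2).
Proof.
move=> hA hAB ht hx hy htA hxA hyB hsum.
have hB : 0 < B by lia.
have htt : (A + B) * t ^+ 2 <= A * B * t by nia.
suff : 4 * (A * y ^+ 2 + B * x ^+ 2 + 2 * t * x * y) <= A * B * (A + B) - 2 * t * A * B by nia.
have sq (C z z' : int) : 0 < C -> 0 <= z -> 2 * z <= z' -> 4 * (C * z ^+ 2) <= C * z' ^+ 2.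
  move=> hC hz hz'; rewrite (_ : _ * _ = C * (2 * z) ^+ 2); last by ring.
  by rewrite ler_pM2l // !expr2; apply: ler_pM => //; lia.
(* The left side grows with [y], whose upper limit is [B/2] as long as [x <= A/2 - t] and half of
   [A + B - 2 t - 2 x] beyond. *)
case: (lerP (2 * x) (A - 2 * t)) => hc.
  have h1 : 4 * (A * y ^+ 2) <= A * B ^+ 2 by apply: sq.
  have h2 : 4 * (B * x ^+ 2) <= B * (A - 2 * t) ^+ 2 by apply: sq.
  have h3 : 8 * (t * x * y) <= 2 * t * (A - 2 * t) * B.
    have : (2 * x) * (2 * y) <= (A - 2 * t) * B by apply: ler_pM; lia.
    by nia.
  have h4 : 0 <= B * t ^+ 2 by rewrite mulr_ge0 ?sqr_ge0 // ltW.
  by nia.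
set Y := A + B - 2 * t - 2 * x.
have hY : 2 * y <= Y by rewrite /Y; lia.
have h1 : 4 * (A * y ^+ 2) <= A * Y ^+ 2 by apply: sq.
have h3 : 8 * (t * x * y) <= 4 * t * x * Y.
  have : (t * x) * (2 * y) <= (t * x) * Y by apply: ler_wpM2l => //; apply: mulr_ge0.
  by lia.
have h4 : 0 <= (A + B - 2 * t) * ((A - 2 * x) * (2 * x - A + 2 * t)).
  by rewrite mulr_ge0 ?mulr_ge0 //; lia.
suff : A * Y ^+ 2 + 4 * (B * x ^+ 2) + 4 * t * x * Y = A * B * (A + B) - 2 * t * A * B
   - (A + B - 2 * t) * ((A - 2 * x) * (2 * x - A + 2 * t)) by lia.
by rewrite /Y; ring.
Qed.

Section ReducedBounds.
Variable F : tform.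
Hypotheses (hF : posdef F) (hR : reduced F).

(** Changing signs of basis vectors leaves the product [s12 * s13 * s23] alone, so its sign alone
    decides which of the two inequalities applies. *)
Lemma red_cover : 4 * (D1 F * s23 F ^+ 2 + D2 F * s13 F ^+ 2 - 2 * s12 F * s13 F * s23 F)
  <= (D1 F + D2 F) * (D1 F * D2 F - s12 F ^+ 2).
Proof.
have [_ _ _ [h1 h2 h3 _]] := posdef_all hF.
have r12 := red_s12 hR; have r13 := red_s13 hR; have r23 := red_s23 hR.
have h12 := red12 hR.
have k1 := red_x3 hR 1 1; have k2 := red_x3 hR 1 (-1).
have k3 := red_x3 hR (-1) 1; have k4 := red_x3 hR (-1) (-1).
rewrite /Dv in k1 k2 k3 k4.
move: (D1 F) (D2 F) (D3 F) (s12 F) (s13 F) (s23 F) h1 h2 h3 h12 r12 r13 r23 k1 k2 k3 k4.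
move=> A B C s x y h1 h2 h3 h12 r12 r13 r23 k1 k2 k3 k4.
have hp := @seeber_pos A B `|s| `|x| `|y| h1 h12 (normr_ge0 _) (normr_ge0 _) (normr_ge0 _) r12 r13 r23.
have hn := @seeber_neg A B `|s| `|x| `|y| h1 h12 (normr_ge0 _) (normr_ge0 _) (normr_ge0 _) r12 r13 r23.
rewrite !real_normK ?num_real // in hp hn.
case: (lerP 0 s) hp hn; case: (lerP 0 x); case: (lerP 0 y) => hy hx hs hp hn.
all: try by lia.
all: by have := hn; lia.
Qed.

(** [D3] is the squared length of the projection, at most [(D1 + D2)/4], plus the squared distance
    to the plane, a quotient of determinants: [4 disc^2 / (4 disc fc) = disc / fc]. *)
Lemma red_D3 : 4 * (fc F * D3 F) <= 4 * disc F + (D1 F + D2 F) * fc F.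
Proof.
have [_ _ _ [_ _ _ hd]] := posdef_all hF.
have h := red_cover; have hdet := detD F; have hm := minor12 F.
have : 4 * disc F * (4 * (fc F * D3 F)) <= 4 * disc F * (4 * disc F + (D1 F + D2 F) * fc F).
  have e1 : D3 F * (D1 F * D2 F - s12 F ^+ 2) = D3 F * (4 * disc F * fc F) by rewrite hm.
  by rewrite hm in h; lia.
by rewrite ler_pM2l //; lia.
Qed.

(** Discriminant 1 would give [fc * D3 <= 2] by [red_D3], while every nonzero value of [D] is at
    least 3. This later provides a prime dividing the discriminant. *)
Lemma red_disc_gt1 : 1 < disc F.
Proof.
have [_ _ hc [h1 h2 h3 hd]] := posdef_all hF.
have h := red_D3; have h12 := red12 hR; have h23 := red23 hR.
have : 3 <= D1 F.
  by rewrite (_ : D1 F = Dv F 1 0 0); [apply: Dv_ge3 | fring].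
by move: h hc h12 h23; clear; nia.
Qed.

Lemma Dv_sq2 (x y z : int) : D1 F * (D1 F * D2 F - s12 F ^+ 2) * Dv F x y z =
  (D1 F * D2 F - s12 F ^+ 2) * (D1 F * x + s12 F * y + s13 F * z) ^+ 2
  + ((D1 F * D2 F - s12 F ^+ 2) * y + (D1 F * s23 F - s12 F * s13 F) * z) ^+ 2
  + 4 * disc F ^+ 2 * D1 F * z ^+ 2.
Proof. fring. Qed.

(** For [|z| >= 2] the distance to the plane is enough: [D >= 4 disc / fc >= 4 D3 - D1 - D2 >= 2
    D3]. *)
Lemma red_min3 (x y z : int) : z != 0 -> D3 F <= Dv F x y z.
Proof.
move=> hz; have [_ _ hc [h1 h2 h3 hd]] := posdef_all hF.
case: (eqVneq z 1) => [->|z1]; first exact: (red_x3 hR).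
case: (eqVneq z (-1)) => [->|zm1].
  by rewrite -(DvN F x y) opprK; apply: (red_x3 hR).
have hz2 : 4 <= z ^+ 2 by move: hz z1 zm1; clear; nia.
have hm := minor12 F; set Dl := D1 F * D2 F - s12 F ^+ 2 in hm.
have hDl : 0 < Dl by rewrite hm !mulr_gt0.
have h := Dv_sq2 x y z; rewrite -/Dl in h.
have p1 := mulr_ge0 (ltW hDl) (sqr_ge0 (D1 F * x + s12 F * y + s13 F * z)).
have p2 := sqr_ge0 (Dl * y + (D1 F * s23 F - s12 F * s13 F) * z).
have h4 : 4 * disc F * D1 F * (disc F * z ^+ 2) <= 4 * disc F * D1 F * (fc F * Dv F x y z).
  have -> : 4 * disc F * D1 F * (fc F * Dv F x y z) = D1 F * Dl * Dv F x y z by rewrite hm; ring.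
  by rewrite h; lia.
rewrite ler_pM2l ?mulr_gt0 // in h4.
have h5 : 4 * disc F <= disc F * z ^+ 2 by rewrite mulrC ler_pM2l.
have h6 := red_D3; have h12 := red12 hR; have h23 := red23 hR.
have h7 : (D1 F + D2 F) * fc F <= 2 * (fc F * D3 F) by move: h12 h23 hc; clear; nia.
rewrite -(ler_pM2l hc).
have h8 : 0 < fc F * D3 F by rewrite mulr_gt0.
lia.
Qed.

Lemma red_min2 (x y z : int) : (y != 0) || (z != 0) -> D2 F <= Dv F x y z.
Proof.
have [_ _ hc [h1 h2 h3 hd]] := posdef_all hF.
case: (eqVneq z 0) => [->|hz _]; last by apply: le_trans (red23 hR) (red_min3 _ _ hz).
rewrite orbF => hy.
case: (eqVneq y 1) => [->|y1]; first exact: (red_x2 hR).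
case: (eqVneq y (-1)) => [->|ym1].
  by rewrite -(DvN F x) opprK oppr0; apply: (red_x2 hR).
have hy2 : 4 <= y ^+ 2 by move: hy y1 ym1; clear; nia.
have e : D1 F * Dv F x y 0 = (D1 F * x + s12 F * y) ^+ 2 + (D1 F * D2 F - s12 F ^+ 2) * y ^+ 2.
  by fring.
have p1 := sqr_ge0 (D1 F * x + s12 F * y).
have r := red_s12 hR; have h12 := red12 hR.
have hs : 4 * s12 F ^+ 2 <= D1 F ^+ 2.
  by move: r; clear; case: (lerP 0 (s12 F)) => *; nia.
have hDl : 3 * (D1 F * D2 F) <= 4 * (D1 F * D2 F - s12 F ^+ 2).
  by move: hs h12 h1; clear; nia.
have h0 : 0 < D1 F * D2 F by rewrite mulr_gt0.
have h4 : 4 * (D1 F * D2 F - s12 F ^+ 2) <= (D1 F * D2 F - s12 F ^+ 2) * y ^+ 2.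
  by rewrite mulrC ler_pM2l //; lia.
rewrite -(ler_pM2l h1); lia.
Qed.

Lemma red_min1 (x y z : int) : [|| x != 0, y != 0 | z != 0] -> D1 F <= Dv F x y z.
Proof.
have [_ _ hc [h1 h2 h3 hd]] := posdef_all hF.
case: (boolP ((y != 0) || (z != 0))) => [hyz _|].
  by apply: le_trans (red12 hR) (red_min2 _ hyz).
rewrite negb_or !negbK => /andP[/eqP -> /eqP ->]; rewrite !orbF => hx.
rewrite (_ : Dv F x 0 0 = D1 F * x ^+ 2); last by fring.
have hx2 : 1 <= x ^+ 2 by move: hx; clear; nia.
by rewrite ler_peMr // ltW.
Qed.

End ReducedBounds.

(** * Minima of a reduced form of prime discriminant *)

Definition rep F (M : int) := exists x y z, Dv F x y z = M.

Lemma Dv100 F : Dv F 1 0 0 = D1 F. Proof. fring. Qed.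
Lemma Dv010 F : Dv F 0 1 0 = D2 F. Proof. fring. Qed.
Lemma Dv001 F : Dv F 0 0 1 = D3 F. Proof. fring. Qed.

Lemma prime_sq_eq (p : nat) (s t k : int) : prime p -> s ^+ 2 - t ^+ 2 = p%:Z * k ->
  2 * `|s| < p%:Z -> 2 * `|t| < p%:Z -> s = t \/ s = - t.
Proof.
move=> hp e hs ht.
have : (p %| absz (s - t)%R * absz (s + t)%R)%N.
  by rewrite -abszM (_ : _ * _ = p%:Z * k) ?abszM ?absz_nat ?dvdn_mulr // -e; ring.
rewrite Euclid_dvdM // => /orP[]; rewrite /dvdn => /eqP hmod; [left|right].
- by have : (absz (s - t)%R %% p = absz (s - t)%R)%N; [rewrite modn_small //; lia | lia].
- by have : (absz (s + t)%R %% p = absz (s + t)%R)%N; [rewrite modn_small //; lia | lia].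
Qed.

Lemma red_D1_ge3 F : posdef F -> 3 <= D1 F.
Proof. by move=> hF; rewrite -Dv100; apply: Dv_ge3. Qed.

Lemma D1_mod4 F : exists q : int, D1 F = 4 * q \/ D1 F = 4 * q + 3.
Proof. by rewrite -Dv100; apply: Dv_mod4_cases. Qed.

Lemma D2_mod4 F : exists q : int, D2 F = 4 * q \/ D2 F = 4 * q + 3.
Proof. by rewrite -Dv010; apply: Dv_mod4_cases. Qed.

Lemma red_s12_sq F : posdef F -> reduced F -> 4 * s12 F ^+ 2 <= D1 F ^+ 2.
Proof.
move=> hF hR; have r := red_s12 hR; have := red_D1_ge3 hF.
by move: r; clear; case: (lerP 0 (s12 F)) => *; nia.
Qed.

Lemma Dv_even_c1 F (u v : int) : fc F = 1 -> fu F = 2 * u -> fv F = 2 * v ->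
  Dv F v u 1 = disc F.
Proof. by rewrite /Dv /D1 /D2 /D3 /s12 /s13 /s23 /disc => -> -> ->; ring. Qed.

Record prime_reduced (p : nat) F : Prop := PrimeReduced {
  pr_prime : prime p;
  pr_posdef : posdef F;
  pr_reduced : reduced F;
  pr_disc : disc F = p%:Z }.

Section OneForm.
Variables (F : tform) (p : nat).
Hypothesis hpF : prime_reduced p F.

(** Hermite's bound for a reduced plane, whose Gram determinant here is [4 p fc]. *)
Lemma red_prod12 : 3 * (D1 F * D2 F) <= 16 * (p%:Z * fc F).
Proof.
have [hp hF hR hd] := hpF.
have hm := minor12 F; rewrite hd in hm.
have hs := red_s12_sq hF hR; have h12 := red12 hR; have h3 := red_D1_ge3 hF.
have : D1 F ^+ 2 <= D1 F * D2 F by move: h12 h3; clear; nia.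
by lia.
Qed.

Lemma red_D3_lt : 1 < fc F -> D3 F < p%:Z.
Proof.
have [hp hF hR hd] := hpF.
move=> hc; rewrite ltNge; apply/negP => hge.
have h := red_D3 hF hR; rewrite hd in h.
have h12 := red12 hR; have h23 := red23 hR; have h3 := red_D1_ge3 hF.
(* For [fc >= 2], [red_D3] and the ordering give [D3 <= p]. Equality then holds throughout, so
   [D1 = D2 = p], but two independent vectors cannot share the norm [p]. *)
have e3 : D3 F = p%:Z by move: h h12 h23 h3 hge hc; clear; nia.
have e12 : D1 F = D2 F /\ D2 F = p%:Z by move: h h12 h23 h3 e3 hc; clear; nia.
have := @Dv_distinct F p 1 0 0 0 1 0 hF hd hp.
rewrite Dv100 Dv010 => /(_ e12.1); rewrite e12.1 e12.2 => /(_ (lexx _)) [] [] //.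
Qed.

(* If s12 = 2 or -2, an integral translate of the third basis vector has norm p < D2. *)
Lemma red_s12_eq0 : fc F = 1 -> D1 F = 4 -> s12 F = 0.
Proof.
have [hp hF hR hd] := hpF.
move=> hc h1; have hm := minor12 F; rewrite hd hc h1 in hm.
have r := red_s12 hR; rewrite h1 in r.
have [//|hs] : s12 F = 0 \/ s12 F ^+ 2 = 4.
  have : [|| s12 F == 0, s12 F ^+ 2 == 4, s12 F == 1 | s12 F == - 1].
    by move: r; clear; case: (lerP 0 (s12 F)) => *; nia.
  by case/or4P => /eqP e; [left | right | exfalso; rewrite e in hm; lia..].
have e2 : D2 F = p%:Z + 1 by lia.
have h12 := red12 hR; have h23 := red23 hR.
have [q hq] := D2_mod4 F.
have [u hu] : exists u, fu F = 2 * u.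
  have := h1; rewrite /D1 hc => e; exists (fu F %/ 2)%Z.
  by have := divz_eq (fu F) 2; have := modz_ge0 (fu F) (isT : 2 != 0 :> int);
    have := ltz_pmod (fu F) (isT : 0 < 2 :> int); nia.
have [v hv] : exists v, fv F = 2 * v.
  have := e2; rewrite {1}/D2 hc => e; exists (fv F %/ 2)%Z.
  have := divz_eq (fv F) 2; have := modz_ge0 (fv F) (isT : 2 != 0 :> int).
  have := ltz_pmod (fv F) (isT : 0 < 2 :> int); set m := (_ %/ _)%Z; set k := (_ %% _)%Z.
  move=> k2 k0 ek; have [k0'|k1] : k = 0 \/ k = 1 by lia.
    by rewrite ek k0'; lia.
  (* An odd [fv] makes [D2 = p + 1] congruent to 3 modulo 4, so [p] is even, [p = 2], and [D2 = 3]
     falls below [D1 = 4]. *)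
  exfalso; rewrite ek k1 in e.
  have ep : (p = 2 * absz (2 * (fa F - m ^+ 2 - m) - 1)%R)%N by lia.
  have p2 : p = 2%N.
    by apply/eqP; rewrite eq_sym -(dvdn_prime2 _ hp) // ep dvdn_mulr.
  by rewrite e2 h1 p2 in h12; lia.
have := red_x3 hR v u; rewrite Dv_even_c1 // hd; lia.
Qed.

(** Covers the small primes, for which even the first minimum escapes [rep_sub]. Hermite's bound
    leaves 3 and 4, and [D1 = 4] would give [D2 = p = 4]. *)
Lemma red_D1_big : p%:Z <= D1 F -> D1 F = 3.
Proof.
have [hp hF hR hd] := hpF.
move=> hle; have h3 := red_D1_ge3 hF; have h12 := red12 hR; have h23 := red23 hR.
have [_ _ hc0 _] := posdef_all hF.
have hc : fc F = 1.
  by case: (ltrP 1 (fc F)) => h; [have := red_D3_lt h; lia | lia].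
have hpr := red_prod12; rewrite hc mulr1 in hpr.
have h5 : D1 F <= 5 by move: hpr hle h12 h3; clear; nia.
have [q hq] := D1_mod4 F.
have [//|h4] : D1 F = 3 \/ D1 F = 4 by lia.
have hs := red_s12_eq0 hc h4; have hm := minor12 F; rewrite hd hc h4 hs in hm.
rewrite h4 in h12 hle.
have e : p = 4%N \/ (p < 4)%N by lia.
have [e4|hp4] := e; first by move: hp; rewrite e4.
by lia.
Qed.

End OneForm.

(** * Comparison of two reduced forms with the same represented numbers *)

Definition rep_sub (p : nat) F G :=
  forall M : int, 0 < M -> M < p%:Z -> rep F M -> rep G M.

Section Comparison.
Variables (p : nat) (F G : tform).
Hypotheses (hpF : prime_reduced p F) (hpG : prime_reduced p G).

Lemma rep_D1_le : rep_sub p F G -> D1 F < p%:Z -> D1 G <= D1 F.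
Proof.
have [hp hF rF dF] := hpF; have [_ hG rG dG] := hpG.
move=> hrep hlt; have h3 := red_D1_ge3 hF.
have [x [y [z e]]] : rep G (D1 F).
  by apply: hrep => //; [lia | exists 1, 0, 0; apply: Dv100].
rewrite -e; apply: red_min1 => //.
apply/negP => /negP; rewrite !negb_or !negbK => /and3P[/eqP x0 /eqP y0 /eqP z0].
by move: e; rewrite x0 y0 z0 /Dv; lia.
Qed.

(** If [G] represented [D2 F] only on its first axis, then, as the first minima agree, so would [F]:
    two independent vectors of [F] would have the same norm below [p]. *)
Lemma rep_D2_le : rep_sub p F G -> D2 F < p%:Z -> D1 F = D1 G -> D2 G <= D2 F.
Proof.
have [hp hF rF dF] := hpF; have [_ hG rG dG] := hpG.
move=> hrep hlt e1; have h3 := red_D1_ge3 hF; have h12 := red12 rF.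
have [x [y [z e]]] : rep G (D2 F).
  by apply: hrep => //; [lia | exists 0, 1, 0; apply: Dv010].
case: (boolP ((y != 0) || (z != 0))) => [h|]; first by rewrite -e; apply: red_min2.
rewrite negb_or !negbK => /andP[/eqP y0 /eqP z0].
have e' : Dv F 0 1 0 = Dv F x 0 0.
  by rewrite Dv010 -e y0 z0 /Dv e1; ring.
have := Dv_distinct hF dF hp e'; rewrite Dv010 ltW // => /(_ isT) [] [] //.
Qed.

Lemma s12_eq : D1 F = D1 G -> D2 F = D2 G -> D2 F < p%:Z ->
  s12 F = s12 G \/ s12 F = - s12 G.
Proof.
have [hp hF rF dF] := hpF; have [_ hG rG dG] := hpG.
move=> e1 e2 hlt; have mF := minor12 F; have mG := minor12 G.
have h12 := red12 rF; have r := red_s12 rF; have r' := red_s12 rG.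
rewrite dF in mF; rewrite dG -e1 -e2 in mG.
by apply: (@prime_sq_eq p _ _ (4 * (fc G - fc F))) => //; lia.
Qed.

(** As for the second minimum, with the plane of the first two vectors in place of the axis; its
    Gram matrix agrees in [F] and [G] up to the sign of [s12], absorbed by [- y]. *)
Lemma rep_D3_le : rep_sub p F G -> D3 F < p%:Z -> D1 F = D1 G -> D2 F = D2 G -> D3 G <= D3 F.
Proof.
have [hp hF rF dF] := hpF; have [_ hG rG dG] := hpG.
move=> hrep hlt e1 e2; have h3 := red_D1_ge3 hF; have h12 := red12 rF; have h23 := red23 rF.
have [x [y [z e]]] : rep G (D3 F).
  by apply: hrep => //; [lia | exists 0, 0, 1; apply: Dv001].
case: (eqVneq z 0) => [z0|h]; last by rewrite -e; apply: red_min3.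
have [y' e'] : exists y', Dv F 0 0 1 = Dv F x y' 0.
  have [|es|es] := s12_eq e1 e2; first by lia.
  - by exists y; rewrite Dv001 -e z0 /Dv e1 e2 es; ring.
  - by exists (- y); rewrite Dv001 -e z0 /Dv e1 e2 es; ring.
have := Dv_distinct hF dF hp e'; rewrite Dv001 ltW // => /(_ isT) [] [] //.
Qed.

End Comparison.

(** * Recovering a form from its Gram data *)

Lemma tform_eq F G : fa F = fa G -> fb F = fb G -> fc F = fc G ->
  fu F = fu G -> fv F = fv G -> fw F = fw G -> F = G.
Proof. by case: F => ? ? ? ? ? ?; case: G => /= ? ? ? ? ? ? -> -> -> -> -> ->. Qed.

(** The adjoint of [D] is a multiple of [F]: each minor of the Gram matrix is [disc F] times a
    coefficient of [F], up to a factor 2 or 4. *)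
Lemma gram_inj F G : 0 < disc F -> disc F = disc G ->
  D1 F = D1 G -> D2 F = D2 G -> D3 F = D3 G ->
  s12 F = s12 G -> s13 F = s13 G -> s23 F = s23 G -> F = G.
Proof.
move=> hd ed e1 e2 e3 e12 e13 e23.
have can (x y : int) : disc F * x = disc F * y -> x = y by apply/mulfI/lt0r_neq0.
apply: tform_eq; apply: can.
- by have := minor23 F; have := minor23 G; rewrite -ed -e2 -e3 -e23; lia.
- by have := minor13 F; have := minor13 G; rewrite -ed -e1 -e3 -e13; lia.
- by have := minor12 F; have := minor12 G; rewrite -ed -e2 -e1 -e12; lia.
- have H K : 2 * (disc K * fu K) = s12 K * s13 K - D1 K * s23 K by fring.
  by have := H F; have := H G; rewrite -ed -e1 -e12 -e13 -e23; lia.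
- have H K : 2 * (disc K * fv K) = s12 K * s23 K - D2 K * s13 K by fring.
  by have := H F; have := H G; rewrite -ed -e2 -e12 -e13 -e23; lia.
- have H K : 2 * (disc K * fw K) = s13 K * s23 K - D3 K * s12 K by fring.
  by have := H F; have := H G; rewrite -ed -e3 -e12 -e13 -e23; lia.
Qed.

(** Sign changes of basis vectors realise the four sign patterns of product 1. In the other four the
    determinant forces [s12 * s13 * s23] to equal its own negative, so some entry vanishes and its
    sign is free. *)
Lemma stable_gram_sign (P : tform -> Prop) F G : stable P -> P G ->
  0 < disc F -> disc F = disc G ->
  D1 F = D1 G -> D2 F = D2 G -> D3 F = D3 G ->
  s12 F = s12 G \/ s12 F = - s12 G -> s13 F = s13 G \/ s13 F = - s13 G ->
  s23 F = s23 G \/ s23 F = - s23 G -> P F.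
Proof.
move=> hP hG hd ed e1 e2 e3 h12 h13 h23.
have c0 : [/\ s12 F = s12 G, s13 F = s13 G & s23 F = s23 G] -> P F.
  by move=> [a b c]; rewrite (gram_inj hd ed e1 e2 e3 a b c).
have c1 : [/\ s12 F = - s12 G, s13 F = - s13 G & s23 F = s23 G] -> P F.
  move=> [a b c]; rewrite (_ : F = neg1 G); first exact: stable_neg1.
  by apply: gram_inj => //; rewrite ?ed ?e1 ?e2 ?e3 ?a ?b ?c; fring.
have c2 : [/\ s12 F = - s12 G, s13 F = s13 G & s23 F = - s23 G] -> P F.
  move=> [a b c]; rewrite (_ : F = neg2 G); first exact: stable_neg2.
  by apply: gram_inj => //; rewrite ?ed ?e1 ?e2 ?e3 ?a ?b ?c; fring.
have c3 : [/\ s12 F = s12 G, s13 F = - s13 G & s23 F = - s23 G] -> P F.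
  move=> [a b c]; rewrite (_ : F = neg3 G); first exact: stable_neg3.
  by apply: gram_inj => //; rewrite ?ed ?e1 ?e2 ?e3 ?a ?b ?c; fring.
have hdet : s12 F * s13 F * s23 F = s12 G * s13 G * s23 G.
  have sq x y : x = y \/ x = - y -> x ^+ 2 = y ^+ 2 :> int.
    by case=> ->; rewrite ?sqrrN.
  have := detD F; have := detD G.
  rewrite -ed -e1 -e2 -e3 -(sq _ _ h12) -(sq _ _ h13) -(sq _ _ h23); lia.
have hz : s12 F * s13 F * s23 F = 0 -> [\/ s12 F = 0, s13 F = 0 | s23 F = 0].
  move=> /eqP; rewrite !mulf_eq0 -orbA => /or3P[] /eqP ->;
  by [apply: Or31 | apply: Or32 | apply: Or33].
case: h12 h13 h23 => a [] b [] c; try by [apply: c0 | apply: c1 | apply: c2 | apply: c3].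
all: have [h|h|h] := hz ltac:(rewrite {1}a {1}b {1}c in hdet; lia).
all: try by apply: c0; split; lia.
all: try by apply: c1; split; lia.
all: try by apply: c2; split; lia.
all: try by apply: c3; split; lia.
Qed.

Lemma congr_sq_mod4 (x y q r : int) : 4 * q - x ^+ 2 = 4 * r - y ^+ 2 ->
  exists m, x = y + 2 * m.
Proof.
move=> e; exists ((x - y) %/ 2)%Z.
have := divz_eq (x - y) 2; have := modz_ge0 (x - y) (isT : 2 != 0 :> int).
have := ltz_pmod (x - y) (isT : 0 < 2 :> int); set m := (_ %/ _)%Z; set k := (_ %% _)%Z.
move=> k2 k0 ek; have [k0'|k1] : k = 0 \/ k = 1 by lia.
  by lia.
exfalso; have ex : x = y + (2 * m + 1) by lia.
rewrite ex in e; have : 2 * (2 * (q - r) - y * (2 * m + 1) - 2 * m ^+ 2 - 2 * m) = 1 by lia.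
by lia.
Qed.

(** [D1] and [D2] fix [fu] and [fv] modulo 2. With [fc = 1], shears change these two by arbitrary
    even amounts, and then [D1], [D2], [s12] give back [fb], [fa], [fw]. *)
Lemma stable_c1 (P : tform -> Prop) F G : stable P -> P G -> fc F = 1 -> fc G = 1 ->
  D1 F = D1 G -> D2 F = D2 G -> s12 F = s12 G \/ s12 F = - s12 G -> P F.
Proof.
move=> hP hG cF cG e1 e2 e12.
wlog {e12} e12 : G hG cG e1 e2 / s12 F = s12 G.
  move=> H; case: e12 => e12; first exact: (H G).
  apply: (H (neg1 G)) => //; first exact: stable_neg1.
  - by rewrite e2; fring.
  - by rewrite e12; fring.
have [n hn] : exists n, fu F = fu G + 2 * n.
  by apply: (@congr_sq_mod4 _ _ (fb F) (fb G)); move: e1; rewrite /D1 cF cG; lia.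
have [m hm] : exists m, fv F = fv G + 2 * m.
  by apply: (@congr_sq_mod4 _ _ (fa F) (fa G)); move: e2; rewrite /D2 cF cG; lia.
set K := shear31 (- m) (shear32 (- n) G).
have hK : P K by apply: stable_shear31 => //; apply: stable_shear32.
have kc : fc K = 1 by rewrite /= cG.
have k1 : D1 F = D1 K by rewrite e1; fring.
have k2 : D2 F = D2 K by rewrite e2; fring.
have k12 : s12 F = s12 K by rewrite e12; fring.
have ku : fu F = fu K by rewrite hn /= cG; ring.
have kv : fv F = fv K by rewrite hm /= cG; ring.
rewrite (_ : F = K) //; apply: tform_eq => //; last 1 first.
- by move: k12; rewrite /s12 cF kc ku kv; lia.
- by move: k2; rewrite /D2 cF kc kv; lia.
- by move: k1; rewrite /D1 cF kc ku; lia.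
- by rewrite cF kc.
Qed.

Section Equality.
Variables (p : nat) (F G : tform).
Hypotheses (hpF : prime_reduced p F) (hpG : prime_reduced p G).
Hypotheses (hFG : rep_sub p F G) (hGF : rep_sub p G F).

Lemma rep_D1_eq : D1 F = D1 G.
Proof.
have [hp hF rF dF] := hpF; have [_ hG rG dG] := hpG.
have leF := rep_D1_le hpF hpG hFG; have leG := rep_D1_le hpG hpF hGF.
case: (ltrP (D1 F) p%:Z) => h; first by have := leF h; lia.
case: (ltrP (D1 G) p%:Z) => h'; first by have := leG h'; lia.
by rewrite (red_D1_big hpF h) (red_D1_big hpG h').
Qed.

Lemma rep_D2_eq : D2 F < p%:Z -> D2 F = D2 G.
Proof.
have [hp hF rF dF] := hpF; have [_ hG rG dG] := hpG.
move=> h; have e := rep_D1_eq.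
have := rep_D2_le hpF hpG hFG h e => h'.
have := rep_D2_le hpG hpF hGF _ (esym e); lia.
Qed.

Lemma fc_eq : D2 F < p%:Z -> fc F = fc G.
Proof.
have [hp hF rF dF] := hpF; have [_ hG rG dG] := hpG.
move=> h; have e1 := rep_D1_eq; have e2 := rep_D2_eq h.
have es := s12_eq hpF hpG e1 e2 h.
have mF := minor12 F; have mG := minor12 G.
have esq : s12 F ^+ 2 = s12 G ^+ 2 by case: es => ->; rewrite ?sqrrN.
rewrite dF in mF; rewrite dG -e1 -e2 -esq mF in mG.
by apply: (@mulfI _ (4 * p%:Z)) => //; have := prime_gt0 hp; lia.
Qed.

Lemma stable_rep_c_gt1 (P : tform -> Prop) : stable P -> P G -> 1 < fc F -> P F.
Proof.
have [hp hF rF dF] := hpF; have [_ hG rG dG] := hpG.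
move=> hP PG hc; have h3 := red_D3_lt hpF hc.
have h12 := red12 rF; have h23 := red23 rF.
have h2 : D2 F < p%:Z by lia.
have e1 := rep_D1_eq; have e2 := rep_D2_eq h2.
have e3 : D3 F = D3 G.
  have h := rep_D3_le hpF hpG hFG h3 e1 e2.
  have := rep_D3_le hpG hpF hGF _ (esym e1) (esym e2); lia.
have mF := minor13 F; have mG := minor13 G; have mF' := minor23 F; have mG' := minor23 G.
rewrite dF in mF mF'; rewrite dG -?e1 -?e2 -?e3 in mG mG'.
have r := red_s13 rF; have r' := red_s13 rG; have t := red_s23 rF; have t' := red_s23 rG.
apply: (stable_gram_sign hP PG) => //.
- by case: hF.
- by rewrite dF dG.
- exact: (s12_eq hpF hpG).
- by apply: (@prime_sq_eq p _ _ (4 * (fb G - fb F))) => //; lia.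
- by apply: (@prime_sq_eq p _ _ (4 * (fa G - fa F))) => //; lia.
Qed.

End Equality.

Lemma stable_rep (p : nat) F G (P : tform -> Prop) : prime_reduced p F -> prime_reduced p G ->
  rep_sub p F G -> rep_sub p G F -> stable P -> P G -> P F.
Proof.
move=> hpF hpG hFG hGF hP PG.
have [hp hF rF dF] := hpF; have [_ hG rG dG] := hpG.
case: (ltrP 1 (fc F)) => hc; first exact: (stable_rep_c_gt1 hpF hpG hFG hGF hP PG hc).
have [_ _ c0 _] := posdef_all hF; have [_ _ c0' _] := posdef_all hG.
have cF : fc F = 1 by lia.
have cG : fc G = 1.
  (* If [fc G > 1], all minima of [G] lie below [p], and the plane determinants can be compared with
     the roles exchanged. *)
  case: (ltrP 1 (fc G)) => hc'; last by lia.
  have := red_D3_lt hpG hc'; have := red23 rG => h23 h3.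
  by rewrite -cF; apply: (fc_eq hpG hpF hGF hFG) => //; lia.
have e1 := rep_D1_eq hpF hpG hFG hGF.
have mF := minor12 F; have mG := minor12 G; rewrite dF cF in mF; rewrite dG cG in mG.
case: (ltrP (D2 F) p%:Z) => h2.
  have e2 := rep_D2_eq hpF hpG hFG hGF h2.
  exact: (stable_c1 hP PG cF cG e1 e2 (s12_eq hpF hpG e1 e2 h2)).
case: (ltrP (D2 G) p%:Z) => h2'.
  have e2 := rep_D2_eq hpG hpF hGF hFG h2'.
  apply: (stable_c1 hP PG cF cG e1 (esym e2)).
  by case: (s12_eq hpG hpF (esym e1) e2 h2') => ->; [left | right; rewrite opprK].
have hpr := red_prod12 hpF; rewrite cF mulr1 in hpr.
have h3 := red_D1_ge3 hF.
have h5 : D1 F <= 5.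
  by have := prime_gt0 hp; move: hpr h2 h3; clear; nia.
have [q hq] := D1_mod4 F.
have r := red_s12 rF; have r' := red_s12 rG.
have [h|h] : D1 F = 3 \/ D1 F = 4 by lia.
  (* Here [3 * D2 = 4 p + s12^2] with [s12] among 0, 1, -1. The residue of [p] modulo 3 decides
     [s12^2], hence [D2], with no help from theta. *)
  rewrite -e1 h in r'; rewrite h in r; rewrite h in mF; rewrite -e1 h in mG.
  have small (s : int) : 2 * `|s| <= 3 -> s = 0 \/ s = 1 \/ s = - 1 by lia.
  apply: (stable_c1 hP PG cF cG e1).
    by case: (small _ r) => [e|[]e]; case: (small _ r') => [e'|[]e'];
      rewrite e in mF; rewrite e' in mG; lia.
  by case: (small _ r) => [e|[]e]; case: (small _ r') => [e'|[]e'];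
      rewrite e in mF *; rewrite e' in mG *; lia.
have sF := red_s12_eq0 hpF cF h.
have sG := red_s12_eq0 hpG cG (etrans (esym e1) h).
apply: (stable_c1 hP PG cF cG e1); last by left; rewrite sF.
by rewrite sF h in mF; rewrite sG -e1 h in mG; lia.
Qed.

(** * Forms modulo a prime dividing the discriminant *)

Section ModPrime.
Variable l : nat.
Hypothesis hl : prime l.

Lemma prime_dvdzM (x y : int) : (l%:Z %| x * y)%Z = (l%:Z %| x)%Z || (l%:Z %| y)%Z.
Proof. by rewrite !dvdzE abszM Euclid_dvdM. Qed.

Lemma prime_dvdz_sq (x : int) : (l%:Z %| x ^+ 2)%Z = (l%:Z %| x)%Z.
Proof. by rewrite expr2 prime_dvdzM orbb. Qed.

Lemma inv_mod_prime (x : int) : ~~ (l%:Z %| x)%Z -> exists t k : int, t * x = 1 + l%:Z * k.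
Proof.
move=> hx; have [u [v e]] := Bezoutz x l%:Z.
have g1 : gcdz x l%:Z = 1.
  by apply/eqP; rewrite -/(coprimez x l) coprimez_sym coprimezE /= prime_coprime.
by exists u, (- v); rewrite -g1 -e; ring.
Qed.

(** Modulo [l], a binary form of vanishing discriminant is [a] times the square of a linear form,
    and [m] is its double root: both the value and the derivative vanish there. *)
Lemma binary_square (a b w : int) : ~~ (l%:Z %| a)%Z -> (l%:Z %| 4 * a * b - w ^+ 2)%Z ->
  exists m, (l%:Z %| b + m * w + m ^+ 2 * a)%Z /\ (l%:Z %| w + 2 * m * a)%Z.
Proof.
move=> ha hm; case: (eqVneq l 2%N) => [l2|l2].
  have par (x : int) : (l%:Z %| x ^+ 2 + x)%Z.
    rewrite l2 (_ : _ + _ = x * (x + 1)); last by ring.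
    have [q hq] : exists q : int, x = 2 * q \/ x = 2 * q + 1.
      by exists (x %/ 2)%Z; have := divz_eq x 2; have := modz_ge0 x (isT : 2 != 0 :> int);
        have := ltz_pmod x (isT : 0 < 2 :> int); lia.
    apply/dvdzP; case: hq => ->; [exists (q * (2 * q + 1)) | exists ((2 * q + 1) * (q + 1))]; ring.
  have hw : (l%:Z %| w)%Z.
    rewrite -prime_dvdz_sq (_ : w ^+ 2 = 2%:Z * (2 * a * b) - (4 * a * b - w ^+ 2)); last by ring.
    by rewrite rpredB // dvdz_mulr // l2.
  have ha1 : (l%:Z %| a + 1)%Z.
    have := par a; rewrite (_ : _ + _ = a * (a + 1)); last by ring.
    by rewrite prime_dvdzM // (negbTE ha).
  (* At 2 the discriminant condition makes [w] even, and squaring is the identity modulo 2, so [b]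
     itself is the root. *)
  exists b; split.
    rewrite (_ : _ + _ = (b ^+ 2 + b) * a + b * w - b * (a + 1) + 2%:Z * b); last by ring.
    by rewrite !rpredD ?rpredN // ?(dvdz_mulr _ (par b)) ?(dvdz_mull _ hw) ?(dvdz_mull _ ha1) // l2 dvdz_mulr.
  rewrite -mulrA rpredD // dvdz_mulr // l2 //.
have h2 : ~~ (l%:Z %| 2 * a)%Z.
  by rewrite prime_dvdzM // negb_or ha andbT dvdzE /= dvdn_prime2.
have [t [k e]] := inv_mod_prime h2.
have hw : (l%:Z %| w + 2 * (- t * w) * a)%Z.
  by apply/dvdzP; exists (- k * w); rewrite (_ : _ + _ = w * (1 - t * (2 * a))); [rewrite e | ]; ring.
exists (- t * w); split => //; set m := - t * w in hw *.
have : (l%:Z %| (2 * a) * (2 * (b + m * w + m ^+ 2 * a)))%Z.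
  rewrite (_ : _ * _ = 4 * a * b - w ^+ 2 + (w + 2 * m * a) * (w + 2 * m * a)); last by ring.
  by rewrite rpredD // dvdz_mull.
rewrite prime_dvdzM // (negbTE h2) /= prime_dvdzM // => /orP[|//].
by rewrite dvdzE /= dvdn_prime2 // (negbTE l2).
Qed.

End ModPrime.

(** In contrast to [shear31], these are named after the effect on [F]: its second or third basis
    vector gains [m] times an earlier one. *)
Definition shear21 m F := swp (shear m (swp F)).
Definition shearf31 m F := rot (shear m (rot (rot F))).
Definition shearf32 m F := swp13 (shear m (swp13 F)).

Section NormalForm.
Variables (l : nat) (d : int) (P : tform -> Prop).
Hypotheses (hl : prime l) (hP : stable P) (hPd : forall F, P F -> disc F = d).
Hypothesis noA : forall F, P F ->
  (l%:Z %| fa F)%Z -> (l%:Z %| fc F)%Z -> (l%:Z %| fv F)%Z -> False.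
Hypothesis noB : forall F, P F ->
  (l%:Z ^+ 2 %| fc F)%Z -> (l%:Z %| fu F)%Z -> (l%:Z %| fv F)%Z -> False.
Hypothesis hld : (l%:Z %| d)%Z.

Lemma stable_shear21 m F : P F -> P (shear21 m F).
Proof. by move=> h; apply: stable_swp => //; apply: stable_shear => //; apply: stable_swp. Qed.
Lemma stable_shearf31 m F : P F -> P (shearf31 m F).
Proof.
by move=> h; apply: stable_rot => //; apply: stable_shear => //; apply: stable_rot => //; apply: stable_rot.
Qed.
Lemma stable_shearf32 m F : P F -> P (shearf32 m F).
Proof. by move=> h; apply: stable_swp13 => //; apply: stable_shear => //; apply: stable_swp13. Qed.

Lemma noA' F : P F -> (l%:Z %| fb F)%Z -> (l%:Z %| fc F)%Z -> (l%:Z %| fu F)%Z -> False.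
Proof. by move=> hF; apply: (noA (stable_swp hP hF)). Qed.

(** If [fa] is a unit, shears clear [fb], [fc], [fv], [fw] modulo [l], and the discriminant becomes
    [- fa * fu^2]; so [fu] vanishes too, against [noA]. If [fa], [fb], [fc] all vanish, so does
    [fv], by [D2]. *)
Lemma normal_rank1 F : P F ->
  (l%:Z %| D1 F)%Z -> (l%:Z %| D2 F)%Z -> (l%:Z %| D3 F)%Z -> False.
Proof.
have main G : P G -> ~~ (l%:Z %| fa G)%Z -> (l%:Z %| D2 G)%Z -> (l%:Z %| D3 G)%Z -> False.
  move=> hG ha h2 h3.
  have [m [hb hw]] := binary_square hl ha h3.
  have [n [hc hv]] := binary_square hl ha h2.
  set K := shearf31 n (shear21 m G).
  have hK : P K by apply/stable_shearf31/stable_shear21.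
  have kb : (l%:Z %| fb K)%Z by [].
  have kc : (l%:Z %| fc K)%Z by [].
  apply: (noA' hK kb kc).
  have := hld; rewrite -(hPd hK) /disc.
  rewrite (_ : _ - _ = fb K * (4 * fa K * fc K - fv K ^+ 2) - fc K * fw K ^+ 2
    + fw K * (fu K * fv K) - fa K * fu K ^+ 2); last by ring.
  rewrite rpredDl; last first.
    by rewrite !rpredD ?rpredN // ?(dvdz_mulr _ kb) ?(dvdz_mulr _ kc) ?(dvdz_mulr _ hw).
  by rewrite rpredN prime_dvdzM // prime_dvdz_sq // (negbTE ha).
move=> hF h1 h2 h3.
have rF := stable_rot hP hF; have rrF := stable_rot hP rF.
case: (boolP (l%:Z %| fa F)%Z) => ha; last exact: (main F).
case: (boolP (l%:Z %| fb F)%Z) => hb.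
  2: { apply: (main (rot F)) => //=.
       by rewrite (_ : D2 _ = D3 F) //; fring. }
case: (boolP (l%:Z %| fc F)%Z) => hc.
  2: { apply: (main (rot (rot F))) => //=.
       - by rewrite (_ : D2 _ = D1 F) //; fring.
       - by rewrite (_ : D3 _ = D2 F) //; fring. }
apply: (noA hF) => //.
rewrite -(prime_dvdz_sq hl) (_ : _ ^+ 2 = fa F * (4 * fc F) - D2 F); last by fring.
by rewrite rpredB // dvdz_mulr.
Qed.

(** The shape at a ramified prime: an anisotropic binary form modulo [l], orthogonal modulo [l] to a
    vector whose value is exactly divisible by [l]. *)
Definition anisotropic_form G := [/\ (l%:Z %| fc G)%Z, (l%:Z %| fu G)%Z, (l%:Z %| fv G)%Z,
  ~~ (l%:Z ^+ 2 %| fc G)%Z &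
  forall x y : int, (l%:Z %| fa G * x ^+ 2 + fw G * x * y + fb G * y ^+ 2)%Z ->
    (l%:Z %| x)%Z /\ (l%:Z %| y)%Z].

Lemma normal_rank2 F : P F -> ~~ (l%:Z %| D3 F)%Z -> exists2 G, P G & anisotropic_form G.
Proof.
move=> hF h3; have [t [k e]] := inv_mod_prime hl h3.
(* Cramer's rule modulo [l], with [t] the inverse of the determinant [D3]: the third vector plus [m]
   times the first and [n] times the second is orthogonal to both. *)
set m := t * (fw F * fu F - 2 * fb F * fv F); set n := t * (fw F * fv F - 2 * fa F * fu F).
set G := shearf31 m (shearf32 n F).
have hG : P G by apply/stable_shearf31/stable_shearf32.
have gu : (l%:Z %| fu G)%Z.
  apply/dvdzP; exists (- k * fu F).
  by rewrite (_ : fu G = fu F * (1 - t * D3 F)); [rewrite e; ring | rewrite /G /m /n; fring].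
have gv : (l%:Z %| fv G)%Z.
  apply/dvdzP; exists (- k * fv F).
  by rewrite (_ : fv G = fv F * (1 - t * D3 F)); [rewrite e; ring | rewrite /G /m /n; fring].
have g3 : D3 G = D3 F by fring.
have gc : (l%:Z %| fc G)%Z.
  have := hld; rewrite -(hPd hG).
  rewrite (_ : disc G = fu G * (fv G * fw G - fa G * fu G) - fv G * (fb G * fv G)
      + fc G * D3 G); last by fring.
  rewrite rpredDl; last by rewrite rpredB ?(dvdz_mulr _ gu) ?(dvdz_mulr _ gv).
  by rewrite prime_dvdzM // g3 (negbTE h3) orbF.
exists G => //; split => //; first by apply/negP => h; apply: (noB hG).
move=> x y hxy.
case: (boolP (l%:Z %| y)%Z) => hy; last first.
  exfalso; have [s [r es]] := inv_mod_prime hl hy.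
  (* Multiplying by the inverse [s] of [y] turns the zero into [(s x, 1)], which the shear makes the
     second basis vector; [fb] becomes a multiple of [l]. *)
  apply: (noA' (stable_shear21 (s * x) hG)) => //=; last by rewrite rpredD // dvdz_mull.
  rewrite (_ : _ + _ = s ^+ 2 * (fa G * x ^+ 2 + fw G * x * y + fb G * y ^+ 2)
     + fb G * (1 - (s * y) ^+ 2) + s * x * fw G * (1 - s * y)); last by rewrite /=; ring.
  rewrite es !rpredD ?(dvdz_mull _ hxy) //; apply/dvdzP.
    by exists (fb G * (- r * (2 + l%:Z * r))); ring.
  by exists (- s * x * fw G * r); ring.
split=> //; case: (boolP (l%:Z %| x)%Z) => // hx; exfalso.
apply: (noA hG) => //.
move: hxy; rewrite (_ : _ + _ = y * (fw G * x + fb G * y) + fa G * x ^+ 2); last by ring.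
rewrite rpredDl ?(dvdz_mulr _ hy) // prime_dvdzM // prime_dvdz_sq // (negbTE hx) orbF //.
Qed.

Lemma exists_anisotropic F : P F -> exists2 G, P G & anisotropic_form G.
Proof.
move=> hF; have rF := stable_rot hP hF; have rrF := stable_rot hP rF.
case: (boolP (l%:Z %| D3 F)%Z) => h3; last exact: normal_rank2 hF h3.
case: (boolP (l%:Z %| D1 F)%Z) => h1.
  2: by apply: (normal_rank2 rF); rewrite (_ : D3 _ = D1 F) //; fring.
case: (boolP (l%:Z %| D2 F)%Z) => h2.
  2: by apply: (normal_rank2 rrF); rewrite (_ : D3 _ = D2 F) //; fring.
by case: (normal_rank1 hF).
Qed.

End NormalForm.

(** Modulo [l^2] the discriminant is [fc * D3], and [D3] is a unit, because a degenerate binary form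
    would have a zero modulo [l]. *)
Lemma anisotropic_disc (l : nat) F : prime l -> anisotropic_form l F ->
  ~~ (l%:Z ^+ 2 %| disc F)%Z.
Proof.
move=> hl [hc hu hv hc2 han].
have h3 : ~~ (l%:Z %| D3 F)%Z.
  apply/negP => h3.
  case: (boolP (l%:Z %| fa F)%Z) => ha.
    have [|] := han 1 0; last by rewrite dvdzE /= dvdn1 => /eqP l1; rewrite l1 in hl.
    by rewrite (_ : _ + _ = fa F) //; ring.
  have [m [hm _]] := binary_square hl ha h3.
  have [|_] := han m 1; last by rewrite dvdzE /= dvdn1 => /eqP l1; rewrite l1 in hl.
  by rewrite (_ : _ + _ = fb F + m * fw F + m ^+ 2 * fa F) //; ring.
apply/negP => h; move/negP: hc2; apply.
rewrite -(@Gauss_dvdzl _ _ (D3 F)); last first.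
  by rewrite coprimezXl // coprimezE /= prime_coprime // -dvdzE.
rewrite (_ : _ * _ = disc F - (fu F * (fv F * fw F - fa F * fu F) - (fb F * fv F) * fv F)); last by fring.
rewrite rpredB // rpredB // expr2 dvdz_mul ?dvdz_mull ?rpredB //.
- by rewrite dvdz_mulr.
- by rewrite dvdz_mull.
Qed.

(** * Even Clifford bases of orders *)

Definition lcomb (i j k : quat) (t x y z : rat) : quat :=
  t *: qone + x *: i + y *: j + z *: k.

(** The relations of the even Clifford algebra for [i = e2 e3], [j = e3 e1], [k = e1 e2], where
    [e1], [e2], [e3] have squares [fa], [fb], [fc]; for instance
    [j k = e3 e1 e1 e2 = fa * e3 e2]. *)
Record clifford_basis (a b : int) (i j k : quat) (F : tform) : Prop := CliffordBasis {
  cb_jk : qmul a b j k = (fa F)%:~R *: qconj i;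
  cb_ki : qmul a b k i = (fb F)%:~R *: qconj j;
  cb_ij : qmul a b i j = (fc F)%:~R *: qconj k;
  cb_ti : qtr i = (fu F)%:~R;
  cb_tj : qtr j = (fv F)%:~R;
  cb_tk : qtr k = (fw F)%:~R;
  cb_ni : qnorm a b i = (fb F * fc F)%:~R;
  cb_nj : qnorm a b j = (fa F * fc F)%:~R;
  cb_nk : qnorm a b k = (fa F * fb F)%:~R;
  cb_pos : posdef F }.

Definition zspan (i j k : quat) : qset := fun q =>
  exists t x y z : int, q = lcomb i j k t%:~R x%:~R y%:~R z%:~R.

Definition order_form (a b : int) (O : qset) (F : tform) : Prop :=
  exists i j k, clifford_basis a b i j k F /\ forall q, O q <-> zspan i j k q.

Ltac lring := rewrite /lcomb; apply: quat_eqP; rewrite ?qcE //=; ring.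

Section Basis.
Variables (a b : int) (i j k : quat) (F : tform).
Hypothesis hB : clifford_basis a b i j k F.

Lemma cb_conj_i : qconj i = (fu F)%:~R *: qone - i. Proof. by rewrite qconjE (cb_ti hB). Qed.
Lemma cb_conj_j : qconj j = (fv F)%:~R *: qone - j. Proof. by rewrite qconjE (cb_tj hB). Qed.
Lemma cb_conj_k : qconj k = (fw F)%:~R *: qone - k. Proof. by rewrite qconjE (cb_tk hB). Qed.

Lemma cb_ii : qmul a b i i = (fu F)%:~R *: i - (fb F * fc F)%:~R *: qone.
Proof. by rewrite qsqr (cb_ti hB) (cb_ni hB). Qed.
Lemma cb_jj : qmul a b j j = (fv F)%:~R *: j - (fa F * fc F)%:~R *: qone.
Proof. by rewrite qsqr (cb_tj hB) (cb_nj hB). Qed.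
Lemma cb_kk : qmul a b k k = (fw F)%:~R *: k - (fa F * fb F)%:~R *: qone.
Proof. by rewrite qsqr (cb_tk hB) (cb_nk hB). Qed.
Lemma cb_kj : qmul a b k j = (fa F)%:~R *: i + (fw F)%:~R *: j + (fv F)%:~R *: k
  - (fv F * fw F)%:~R *: qone.
Proof.
rewrite qmul_swap (cb_jk hB) qtrZ qtr_conj (cb_ti hB) (cb_tj hB) (cb_tk hB) cb_conj_i.
lring.
Qed.
Lemma cb_ik : qmul a b i k = (fb F)%:~R *: j + (fw F)%:~R *: i + (fu F)%:~R *: k
  - (fu F * fw F)%:~R *: qone.
Proof.
rewrite qmul_swap (cb_ki hB) qtrZ qtr_conj (cb_ti hB) (cb_tj hB) (cb_tk hB) cb_conj_j.
lring.
Qed.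
Lemma cb_ji : qmul a b j i = (fc F)%:~R *: k + (fv F)%:~R *: i + (fu F)%:~R *: j
  - (fu F * fv F)%:~R *: qone.
Proof.
rewrite qmul_swap (cb_ij hB) qtrZ qtr_conj (cb_ti hB) (cb_tj hB) (cb_tk hB) cb_conj_k.
lring.
Qed.

Definition cb_table := (cb_ii, cb_jj, cb_kk, cb_kj, cb_ik, cb_ji, cb_jk hB, cb_ki hB,
  cb_ij hB, cb_conj_i, cb_conj_j, cb_conj_k).

Lemma lcomb_norm (t x y z : rat) : 4 * qnorm a b (lcomb i j k t x y z) =
  (2 * t + (fu F)%:~R * x + (fv F)%:~R * y + (fw F)%:~R * z) ^+ 2 +
  ((D1 F)%:~R * x ^+ 2 + (D2 F)%:~R * y ^+ 2 + (D3 F)%:~R * z ^+ 2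
   + 2 * ((s12 F)%:~R * x * y + (s13 F)%:~R * x * z + (s23 F)%:~R * y * z)).
Proof.
rewrite /lcomb !qnormD !qmulDl !qmulZl !qmulZr !qmul1l (cb_jk hB) cb_ik (cb_ij hB).
rewrite cb_conj_k cb_conj_i !qnormZ.
have qtrN q : qtr (- q) = - qtr q by rewrite -scaleN1r qtrZ; ring.
rewrite ?(qtrD, qtrN, qtrZ, qtr1) (cb_ti hB) (cb_tj hB) (cb_tk hB) (cb_ni hB) (cb_nj hB) (cb_nk hB).
rewrite qnorm1 /D1 /D2 /D3 /s12 /s13 /s23; ring.
Qed.

Lemma lcomb_norm_int (t x y z : int) :
  4 * qnorm a b (lcomb i j k t%:~R x%:~R y%:~R z%:~R) =
  ((2 * t + fu F * x + fv F * y + fw F * z) ^+ 2 + Dv F x y z)%:~R.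
Proof. rewrite lcomb_norm /Dv; ring. Qed.

Lemma lcomb_free (t x y z : rat) : lcomb i j k t x y z = 0 ->
  [/\ t = 0, x = 0, y = 0 & z = 0].
Proof.
move=> h; have := lcomb_norm t x y z; rewrite h.
have -> : qnorm a b 0 = 0 by rewrite -(scale0r (0 : quat)) qnormZ; ring.
have [ha _ _ [_ _ h3 hd]] := posdef_all (cb_pos hB).
have qa : 0 < (fa F)%:~R :> rat by rewrite ltr0z.
have q3 : 0 < (D3 F)%:~R :> rat by rewrite ltr0z.
have qd : 0 < (disc F)%:~R :> rat by rewrite ltr0z.
rewrite mulr0; set L := (X in X ^+ 2 + _); set D := (X in _ + X) => e.
pose M := (D3 F)%:~R * z + (s23 F)%:~R * y + (s13 F)%:~R * x.
pose W := 2 * (fa F)%:~R * y - (fw F)%:~R * x.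
have e2 : (fa F)%:~R * (D3 F)%:~R * L ^+ 2 + (fa F)%:~R * M ^+ 2
    + (disc F)%:~R * W ^+ 2 + (disc F)%:~R * (D3 F)%:~R * x ^+ 2 = 0.
  transitivity ((fa F)%:~R * (D3 F)%:~R * (L ^+ 2 + D)); last by rewrite -e mulr0.
  by rewrite /M /W /D /D1 /D2 /D3 /s12 /s13 /s23 /disc; ring.
have q1 := mulr_gt0 qa q3; have q2 := mulr_gt0 qd q3.
have p (r s : rat) : 0 < r -> 0 <= r * s ^+ 2 by move=> hr; rewrite mulr_ge0 ?sqr_ge0 // ltW.
have z0 (r s : rat) : 0 < r -> (r * s ^+ 2 == 0) = (s == 0).
  by move=> hr; rewrite mulf_eq0 (gt_eqF hr) sqrf_eq0.
move/eqP: e2; rewrite !paddr_eq0 ?addr_ge0 ?p // !z0 //.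
move=> /andP[/andP[/andP[/eqP hL /eqP hM] /eqP hW] /eqP x0].
have y0 : y = 0.
  by move/eqP: hW; rewrite /W x0 mulr0 subr0 !mulf_eq0 (gt_eqF qa) /= => /eqP.
have zz0 : z = 0.
  by move/eqP: hM; rewrite /M x0 y0 !mulr0 !addr0 mulf_eq0 (gt_eqF q3) => /eqP.
split => //; move/eqP: hL; rewrite /L x0 y0 zz0 !mulr0 !addr0 mulf_eq0 /= => /eqP.
exact.
Qed.

Lemma lcomb_inj (t x y z t' x' y' z' : rat) :
  lcomb i j k t x y z = lcomb i j k t' x' y' z' -> [/\ t = t', x = x', y = y' & z = z'].
Proof.
move=> e; have : lcomb i j k (t - t') (x - x') (y - y') (z - z') = 0.
  rewrite (_ : lcomb i j k (t - t') (x - x') (y - y') (z - z')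
    = lcomb i j k t x y z - lcomb i j k t' x' y' z'); first by rewrite e subrr.
  lring.
by move=> /lcomb_free[] /eqP h1 /eqP h2 /eqP h3 /eqP h4; split; apply/eqP; rewrite -subr_eq0.
Qed.

Lemma lcomb_mul (t x y z t' x' y' z' : int) :
  qmul a b (lcomb i j k t%:~R x%:~R y%:~R z%:~R) (lcomb i j k t'%:~R x'%:~R y'%:~R z'%:~R) =
  lcomb i j k
   (t * t' - fb F * fc F * x * x' - fa F * fc F * y * y' - fa F * fb F * z * z'
    + fa F * fu F * y * z' + fb F * fv F * z * x' + fc F * fw F * x * y'
    - fv F * fw F * z * y' - fu F * fw F * x * z' - fu F * fv F * y * x')%:~R
   (t * x' + x * t' + fu F * x * x' - fa F * y * z' + fa F * z * y' + fw F * x * z'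
    + fv F * y * x')%:~R
   (t * y' + y * t' + fv F * y * y' - fb F * z * x' + fw F * z * y' + fb F * x * z'
    + fu F * y * x')%:~R
   (t * z' + z * t' + fw F * z * z' - fc F * x * y' + fv F * z * y' + fu F * x * z'
    + fc F * y * x')%:~R.
Proof.
rewrite {1 2}/lcomb !qmulDl !qmulDr !qmulZl !qmulZr !qmul1l !qmul1r !cb_table.
lring.
Qed.

Lemma zspan_mul x y : zspan i j k x -> zspan i j k y -> zspan i j k (qmul a b x y).
Proof.
move=> [t [x1 [x2 [x3 ->]]]] [t' [y1 [y2 [y3 ->]]]]; rewrite lcomb_mul.
by do 4 eexists.
Qed.

Lemma zspan_one : zspan i j k qone.
Proof. exists 1, 0, 0, 0; lring. Qed.

Definition basis_mx : 'M[rat]_4 := \matrix_(m < 4) nth 0 [:: qone; i; j; k] m.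

Lemma mul_basis_mx (r : 'rV[rat]_4) :
  r *m basis_mx = lcomb i j k (r 0 (inord 0)) (r 0 (inord 1)) (r 0 (inord 2)) (r 0 (inord 3)).
Proof.
rewrite mulmx_sum_row !big_ord_recl big_ord0 addr0 !rowK /= /lcomb !addrA.
by do ! congr (_ + _); congr (r _ _ *: _); apply/val_inj; rewrite /= inordK.
Qed.

Lemma basis_mx_unit : basis_mx \in unitmx.
Proof.
rewrite -row_free_unit -kermx_eq0; apply/rowV0P => r /sub_kermxP.
rewrite mul_basis_mx => /lcomb_free[h0 h1 h2 h3].
by apply: quat_eqP; rewrite qc_zero.
Qed.

Lemma zspan_lattice q : zspan i j k q <-> lattice_of basis_mx q.
Proof.
split=> [[t [x [y [z ->]]]]|[r ->]].
  exists (\row_(m < 4) nth 0 [:: t; x; y; z] m).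
  by rewrite mul_basis_mx !mxE !inordK.
by rewrite mul_basis_mx !mxE; do 4 eexists.
Qed.

Lemma zspan_order : is_order a b (zspan i j k).
Proof.
split; first by exists basis_mx; split; [exact: basis_mx_unit | exact: zspan_lattice].
by split; [exact: zspan_one | exact: zspan_mul].
Qed.

End Basis.

Lemma zspan_lin i j k (t x y z : int) (q1 q2 q3 : quat) :
  zspan i j k q1 -> zspan i j k q2 -> zspan i j k q3 ->
  zspan i j k (lcomb q1 q2 q3 t%:~R x%:~R y%:~R z%:~R).
Proof.
move=> [t1 [x1 [y1 [z1 ->]]]] [t2 [x2 [y2 [z2 ->]]]] [t3 [x3 [y3 [z3 ->]]]].
exists (t + x * t1 + y * t2 + z * t3), (x * x1 + y * x2 + z * x3),
  (x * y1 + y * y2 + z * y3), (x * z1 + y * z2 + z * z3).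
lring.
Qed.

Lemma zspan_sub i j k i' j' k' q : zspan i' j' k' i -> zspan i' j' k' j ->
  zspan i' j' k' k -> zspan i j k q -> zspan i' j' k' q.
Proof. by move=> hi hj hk [t [x [y [z ->]]]]; apply: zspan_lin. Qed.

Lemma order_form_change a b O i j k F i' j' k' : (forall q, O q <-> zspan i j k q) ->
  clifford_basis a b i' j' k' F ->
  zspan i j k i' -> zspan i j k j' -> zspan i j k k' ->
  zspan i' j' k' i -> zspan i' j' k' j -> zspan i' j' k' k ->
  order_form a b O F.
Proof.
move=> hO hB h1 h2 h3 h4 h5 h6; exists i', j', k'; split=> // q.
by rewrite hO; split; apply: zspan_sub.
Qed.

Lemma order_form_rot a b O F : order_form a b O F -> order_form a b O (rot F).
Proof.
move=> [i [j [k [hB hO]]]]; apply: (order_form_change (i' := j) (j' := k) (k' := i) hO).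
- case: (hB) => e1 e2 e3 t1 t2 t3 n1 n2 n3 [p1 p2 p3]; split => //=; try by rewrite mulrC.
  have [ha hb hc [h1 h2 h3 hd]] := posdef_all (cb_pos hB).
  by split => //; rewrite (_ : disc _ = disc F) //; fring.
- by exists 0, 0, 1, 0; lring.
- by exists 0, 0, 0, 1; lring.
- by exists 0, 1, 0, 0; lring.
- by exists 0, 0, 0, 1; lring.
- by exists 0, 1, 0, 0; lring.
- by exists 0, 0, 1, 0; lring.
Qed.

(** Exchanging [e1] and [e2] turns [i = e2 e3] into [e1 e3], the conjugate of [j = e3 e1]; hence the
    conjugates, which absorb the change of orientation. *)
Lemma order_form_swp a b O F : order_form a b O F -> order_form a b O (swp F).
Proof.
move=> [i [j [k [hB hO]]]].
apply: (order_form_change (i' := qconj j) (j' := qconj i) (k' := qconj k) hO).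
- case: (hB) => e1 e2 e3 t1 t2 t3 n1 n2 n3 [p1 p2 p3].
  split; rewrite /= -?qconjM ?qconjK ?qtr_conj ?qnorm_conj //; try by rewrite mulrC.
  + by rewrite e2 qconjZ qconjK.
  + by rewrite e1 qconjZ qconjK.
  + by rewrite e3 qconjZ qconjK.
  have [ha hb hc [h1 h2 h3 hd]] := posdef_all (cb_pos hB).
  split => //.
  + by rewrite (_ : D3 _ = D3 F) //; fring.
  + by rewrite (_ : disc _ = disc F) //; fring.
- by rewrite (cb_conj_j hB); exists (fv F), 0, (-1), 0; lring.
- by rewrite (cb_conj_i hB); exists (fu F), (-1), 0, 0; lring.
- by rewrite (cb_conj_k hB); exists (fw F), 0, 0, (-1); lring.
- by rewrite (cb_conj_i hB) (cb_conj_j hB); exists (fu F), 0, (-1), 0; lring.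
- by rewrite (cb_conj_i hB) (cb_conj_j hB); exists (fv F), (-1), 0, 0; lring.
- by rewrite (cb_conj_k hB); exists (fw F), 0, 0, (-1); lring.
Qed.

Lemma order_form_neg1 a b O F : order_form a b O F -> order_form a b O (neg1 F).
Proof.
move=> [i [j [k [hB hO]]]].
apply: (order_form_change (i' := i) (j' := (-1) *: j) (k' := (-1) *: k) hO).
- case: (hB) => e1 e2 e3 t1 t2 t3 n1 n2 n3 [p1 p2 p3].
  split; rewrite /= ?qmulZl ?qmulZr ?qconjZ ?qtrZ ?qnormZ ?e1 ?e2 ?e3 ?t1 ?t2 ?t3 ?n1 ?n2 ?n3 //;
    try lring; try ring.
  split => //.
  + by rewrite (_ : D3 _ = D3 F) //; fring.
  + by rewrite (_ : disc _ = disc F) //; fring.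
- by exists 0, 1, 0, 0; lring.
- by exists 0, 0, (-1), 0; lring.
- by exists 0, 0, 0, (-1); lring.
- by exists 0, 1, 0, 0; lring.
- by exists 0, 0, (-1), 0; lring.
- by exists 0, 0, 0, (-1); lring.
Qed.

Lemma order_form_shear m a b O F : order_form a b O F -> order_form a b O (shear m F).
Proof.
move=> [i [j [k [hB hO]]]].
(* Replacing [e1] by [e1 + m e2] turns [e3 e1] into [j + m * qconj i], and [e1 e2] into
   [k + m * fb F]. *)
pose j' := lcomb i j k (m * fu F)%:~R (- m)%:~R 1%:~R 0%:~R.
pose k' := lcomb i j k (m * fb F)%:~R 0%:~R 0%:~R 1%:~R.
have ej' : j' = j + m%:~R *: qconj i by rewrite (cb_conj_i hB) /j'; lring.
have ek' : k' = k + (m * fb F)%:~R *: qone by rewrite /k'; lring.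
have tj' : qtr j' = (fv F + m * fu F)%:~R.
  by rewrite ej' qtrD qtrZ qtr_conj (cb_tj hB) (cb_ti hB); ring.
have tk' : qtr k' = (fw F + 2 * m * fb F)%:~R.
  by rewrite ek' qtrD qtrZ qtr1 (cb_tk hB); ring.
apply: (order_form_change (i' := i) (j' := j') (k' := k') hO).
- have [ha hb hc [h1 h2 h3 hd]] := posdef_all (cb_pos hB).
  have nj : 4 * qnorm a b j' = (4 * (fa F + m * fw F + m ^+ 2 * fb F) * fc F)%:~R.
    by rewrite (lcomb_norm_int hB); congr _%:~R; rewrite /Dv; fring.
  have nk : 4 * qnorm a b k' = (4 * (fa F + m * fw F + m ^+ 2 * fb F) * fb F)%:~R.
    by rewrite (lcomb_norm_int hB); congr _%:~R; rewrite /Dv; fring.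
  have g3 : D3 (shear m F) = D3 F by fring.
  split; rewrite ?tj' ?tk' //= ?(cb_ti hB) ?(cb_ni hB) //.
  + rewrite ej' ek' (cb_conj_i hB) ?qmul_lin ?(cb_table hB).
    lring.
  + rewrite (qconjE j') tj' ej' ek'.
    rewrite (cb_conj_i hB) ?qmul_lin ?(cb_table hB).
    lring.
  + rewrite (qconjE k') tk' ej' ek'.
    rewrite (cb_conj_i hB) ?qmul_lin ?(cb_table hB).
    lring.
  + by apply: (@mulfI _ 4) => //; rewrite nj; ring.
  + by apply: (@mulfI _ 4) => //; rewrite nk; ring.
  + split; rewrite ?g3 //; last by rewrite (_ : disc _ = disc F) //; fring.
    move: g3 h3; rewrite /= {1}/D3 /=; move: (fa F + _ + _) => A; move: hb; clear; nia.
- by exists 0, 1, 0, 0; lring.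
- by do 4 eexists.
- by do 4 eexists.
- by exists 0, 1, 0, 0; lring.
- by exists (- m * fu F), m, 1, 0; rewrite /j'; lring.
- by exists (- m * fb F), 0, 0, 1; rewrite /k'; lring.
Qed.

Lemma order_form_stable a b O : stable (order_form a b O).
Proof.
split; [exact: order_form_rot|exact: order_form_swp|exact: order_form_neg1|].
by move=> m F; apply: order_form_shear.
Qed.

Lemma order_form_posdef a b O F : order_form a b O F -> posdef F.
Proof. by move=> [i [j [k [hB _]]]]; apply: cb_pos hB. Qed.

(** The multiplication table depends on [F] alone, so equality of coordinates defines a ring
    isomorphism. *)
Lemma order_form_iso a b O O' F : order_form a b O F -> order_form a b O' F ->
  ring_isomorphic a b O O'.
Proof.
move=> [i [j [k [hB hO]]]] [i' [j' [k' [hB' hO']]]].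
pose f (x : quat) : quat := x *m invmx (basis_mx i j k) *m basis_mx i' j' k'.
have fE t x y z : f (lcomb i j k t x y z) = lcomb i' j' k' t x y z.
  pose r : 'rV[rat]_4 := \row_(m < 4) nth 0 [:: t; x; y; z] m.
  have -> : lcomb i j k t x y z = r *m basis_mx i j k.
    by rewrite mul_basis_mx !mxE !inordK.
  by rewrite /f mulmxK ?(basis_mx_unit hB) // mul_basis_mx !mxE !inordK.
exists f; split; [|split; [|split; [|split; [|split]]]].
- by move=> q /hO [t [x [y [z ->]]]]; rewrite fE; apply/hO'; do 4 eexists.
- move=> q /hO' [t [x [y [z ->]]]]; exists (lcomb i j k t%:~R x%:~R y%:~R z%:~R).
  by split; [apply/hO; do 4 eexists | rewrite fE].
- move=> q1 q2 /hO [t [x [y [z ->]]]] /hO [t' [x' [y' [z' ->]]]].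
  by rewrite !fE => /(lcomb_inj hB')[-> -> -> ->].
- have e (q1 q2 q3 : quat) : qone = lcomb q1 q2 q3 1 0 0 0 by lring.
  by rewrite {1}(e i j k) fE -e.
- by move=> q1 q2 _ _; rewrite /f !mulmxDl.
- move=> q1 q2 /hO [t [x [y [z ->]]]] /hO [t' [x' [y' [z' ->]]]].
  by rewrite (lcomb_mul hB) !fE (lcomb_mul hB').
Qed.

(** * Overorders and norms in terms of the form *)

Lemma zspan_self i j k : [/\ zspan i j k i, zspan i j k j & zspan i j k k].
Proof.
by split; [exists 0, 1, 0, 0|exists 0, 0, 1, 0|exists 0, 0, 0, 1]; lring.
Qed.

Lemma maximal_zspan a b O i j k F i' j' k' F' : is_maximal_order a b O ->
  clifford_basis a b i j k F -> (forall q, O q <-> zspan i j k q) ->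
  clifford_basis a b i' j' k' F' ->
  zspan i' j' k' i -> zspan i' j' k' j -> zspan i' j' k' k -> zspan i j k j'.
Proof.
move=> [_ hmax] hB hO hB' hi hj hk; apply/hO.
have [_ h _] := zspan_self i' j' k'; apply: (hmax _ (zspan_order hB')) h.
by move=> x /hO; apply: zspan_sub.
Qed.

Lemma int_div_contra (l : nat) (r : int) : (1 < l)%N -> (l%:~R)^-1 = r%:~R :> rat -> False.
Proof.
move=> hl e; have l0 : l%:~R != 0 :> rat by rewrite intr_eq0; lia.
have : (l%:Z * r)%:~R = 1%:~R :> rat by rewrite intrM -e divff.
by move=> /intr_inj h; case: (lerP r 0) => hr; nia.
Qed.

(* The overorder <1, i, j/l, k> is attached to (1/l) F(x, l y, z). *)
Lemma maximal_noA a b O (l : nat) F : is_maximal_order a b O -> (1 < l)%N -> order_form a b O F ->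
  (l%:Z %| fa F)%Z -> (l%:Z %| fc F)%Z -> (l%:Z %| fv F)%Z -> False.
Proof.
move=> hmax hl [i [j [k [hB hO]]]] /dvdzP[a' ea] /dvdzP[c' ec] /dvdzP[v' ev].
have l0 : l%:~R != 0 :> rat by rewrite intr_eq0; lia.
pose s : rat := (l%:~R)^-1.
pose F' := Form a' (fb F * l%:Z) c' (fu F) v' (fw F).
have hB' : clifford_basis a b i (s *: j) k F'.
  case: (hB) => e1 e2 e3 t1 t2 t3 n1 n2 n3 [p1 p2 p3].
  split; rewrite /= ?qmulZl ?qmulZr ?qconjZ ?qtrZ ?qnormZ ?e1 ?e2 ?e3 ?t1 ?t2 ?t3 ?n1 ?n2 ?n3
    ?scalerA ?ea ?ec ?ev //.
  - by congr (_ *: _); rewrite intrM /s mulrC mulfK.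
  - by congr (_ *: _); rewrite intrM /s mulfK.
  - by congr (_ *: _); rewrite intrM /s mulrC mulfK.
  - by rewrite intrM /s mulrC mulfK.
  - by congr _%:~R; ring.
  - by rewrite !intrM /s; field.
  - by congr _%:~R; ring.
  split => /=.
  - by move: p1; rewrite ea; move: hl; clear; nia.
  - by rewrite (_ : D3 _ = D3 F) //; rewrite /D3 ea /=; ring.
  - have e : disc F = l%:Z * disc F' by rewrite /disc ea ec ev /=; ring.
    by move: p3; rewrite e pmulr_rgt0 //; lia.
have [s1 s2 s3] := zspan_self i (s *: j) k.
have hj : zspan i (s *: j) k j.
  exists 0, 0, l%:Z, 0; rewrite /lcomb scalerA divff // scale1r; lring.
have [t [x [y [z]]]] := maximal_zspan hmax hB hO hB' s1 hj s3.
rewrite (_ : s *: j = lcomb i j k 0 0 s 0); last by lring.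
by move=> /(lcomb_inj hB)[_ _ + _]; apply: int_div_contra.
Qed.

(* The overorder <1, i/l, j/l, k> is attached to F(x, y, z/l). *)
Lemma maximal_noB a b O (l : nat) F : is_maximal_order a b O -> (1 < l)%N -> order_form a b O F ->
  (l%:Z ^+ 2 %| fc F)%Z -> (l%:Z %| fu F)%Z -> (l%:Z %| fv F)%Z -> False.
Proof.
move=> hmax hl [i [j [k [hB hO]]]] /dvdzP[c' ec] /dvdzP[u' eu] /dvdzP[v' ev].
have l0 : l%:~R != 0 :> rat by rewrite intr_eq0; lia.
pose s : rat := (l%:~R)^-1.
pose F' := Form (fa F) (fb F) c' u' v' (fw F).
have hB' : clifford_basis a b (s *: i) (s *: j) k F'.
  case: (hB) => e1 e2 e3 t1 t2 t3 n1 n2 n3 [p1 p2 p3].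
  split; rewrite /= ?qmulZl ?qmulZr ?qconjZ ?qtrZ ?qnormZ ?e1 ?e2 ?e3 ?t1 ?t2 ?t3 ?n1 ?n2 ?n3
    ?scalerA ?eu ?ec ?ev //.
  - by rewrite mulrC.
  - by rewrite mulrC.
  - by congr (_ *: _); rewrite /s; field.
  - by rewrite intrM /s; field.
  - by rewrite intrM /s; field.
  - by rewrite /s; field.
  - by rewrite /s; field.
  split => //=.
  have e : disc F = l%:Z ^+ 2 * disc F' by rewrite /disc ec eu ev /=; ring.
  by move: p3; rewrite e pmulr_rgt0 //; rewrite exprn_gt0 //; lia.
have [s1 s2 s3] := zspan_self (s *: i) (s *: j) k.
have hi : zspan (s *: i) (s *: j) k i.
  exists 0, l%:Z, 0, 0; rewrite /lcomb scalerA divff // scale1r; lring.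
have hj : zspan (s *: i) (s *: j) k j.
  exists 0, 0, l%:Z, 0; rewrite /lcomb !scalerA divff // scale1r; lring.
have [t [x [y [z]]]] := maximal_zspan hmax hB hO hB' hi hj s3.
rewrite (_ : s *: j = lcomb i j k 0 0 s 0); last by lring.
by move=> /(lcomb_inj hB)[_ _ + _]; apply: int_div_contra.
Qed.

Definition normf F (t x y z : int) : int := t ^+ 2 + t * (fu F * x + fv F * y + fw F * z)
  + fb F * fc F * x ^+ 2 + fa F * fc F * y ^+ 2 + fa F * fb F * z ^+ 2
  + (fu F * fv F - fc F * fw F) * x * y + (fu F * fw F - fb F * fv F) * x * z
  + (fv F * fw F - fa F * fu F) * y * z.

Lemma qnorm_lcomb a b i j k F (t x y z : int) : clifford_basis a b i j k F ->
  qnorm a b (lcomb i j k t%:~R x%:~R y%:~R z%:~R) = (normf F t x y z)%:~R.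
Proof.
move=> hB; apply: (@mulfI _ 4) => //; rewrite (lcomb_norm_int hB).
by rewrite /normf /Dv /D1 /D2 /D3 /s12 /s13 /s23; ring.
Qed.

(** Modulo [l] the norm is a binary form in [t] and [z] alone. Once these are multiples of [l], the
    norm modulo [l^2] is [fc] times the binary part of [F] at [(y, -x)], and [l] divides [fc] only
    once. *)
Lemma anisotropic_normf (l : nat) F (t x y z : int) : prime l -> anisotropic_form l F ->
  (l%:Z ^+ 2 %| normf F t x y z)%Z ->
  [/\ (l%:Z %| t)%Z, (l%:Z %| x)%Z, (l%:Z %| y)%Z & (l%:Z %| z)%Z].
Proof.
move=> hl [hc hu hv hc2 han] hN.
have ha : ~~ (l%:Z %| fa F)%Z.
  apply/negP => ha; have [|] := han 1 0; last by rewrite dvdzE /= dvdn1 => /eqP l1; rewrite l1 in hl.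
  by rewrite (_ : _ + _ = fa F) //; ring.
have hN1 : (l%:Z %| normf F t x y z)%Z by apply: dvdz_trans hN; rewrite expr2 dvdz_mulr.
move: hc hu hv hN1 hN hc2 => /dvdzP[c' ec] /dvdzP[u' eu] /dvdzP[v' ev] hN1 hN hc2.
(* a (t^2 + w t z + a b z^2) is the binary form (a, w, b) at (t, a z). *)
have [ht haz] : (l%:Z %| t)%Z /\ (l%:Z %| fa F * z)%Z.
  apply: han.
  rewrite (_ : _ + _ = fa F * normf F t x y z - fa F * l%:Z * (t * (u' * x + v' * y)
    + fb F * c' * x ^+ 2 + fa F * c' * y ^+ 2 + (u' * v' * l%:Z - c' * fw F) * x * y
    + (u' * fw F - fb F * v') * x * z + (v' * fw F - fa F * u') * y * z)); last first.
    by rewrite /normf ec eu ev; ring.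
  by rewrite rpredB ?(dvdz_mull _ hN1) // -!mulrA dvdz_mull // dvdz_mulr.
have hz : (l%:Z %| z)%Z by move: haz; rewrite prime_dvdzM // (negbTE ha).
move: (ht) (hz) => /dvdzP[t' et] /dvdzP[z' ez].
have l0 : l%:Z != 0 by have := prime_gt0 hl; lia.
have hc' : ~~ (l%:Z %| c')%Z.
  by apply: contra hc2; rewrite ec expr2 => h; apply: dvdz_mul.
have h2 : (l%:Z %| c' * (fa F * y ^+ 2 + fw F * y * - x + fb F * (- x) ^+ 2))%Z.
  rewrite -(dvdz_mul2r l0) -expr2.
  rewrite (_ : _ * l%:Z = normf F t x y z - l%:Z ^+ 2 * (t' ^+ 2 + t' * (u' * x + v' * y + fw F * z')
    + fa F * fb F * z' ^+ 2 + u' * v' * x * y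
    + (u' * fw F - fb F * v') * x * z' + (v' * fw F - fa F * u') * y * z')); last first.
    by rewrite /normf ec eu ev et ez; ring.
  by rewrite rpredB // dvdz_mulr.
rewrite prime_dvdzM // (negbTE hc') /= in h2.
by have [hy hx] := han _ _ h2; split=> //; move: hx; rewrite rpredN.
Qed.

(** * Integrality and existence of Clifford bases *)

Lemma clear_denominators (m n : nat) (E : 'M[rat]_(m, n)) :
  exists2 M : int, 0 < M & exists A : 'M[int]_(m, n), M%:~R *: E = map_mx intr A.
Proof.
pose M : int := \prod_(ij : 'I_m * 'I_n) denq (E ij.1 ij.2).
exists M; first by apply: prodr_gt0 => ij _; apply: denq_gt0.
exists (\matrix_(i, j) (numq (E i j) * \prod_(ij : 'I_m * 'I_n | ij != (i, j)) denq (E ij.1 ij.2))).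
apply/matrixP => i j; rewrite !mxE /M (bigD1 (i, j)) //= !intrM.
by rewrite numqE; ring.
Qed.

Lemma bounded_denominators_int (r : rat) (M : int) : 0 < M ->
  (forall k : nat, exists n : int, M%:~R * r ^+ k = n%:~R) -> exists n : int, r = n%:~R.
Proof.
move=> hM h; have d0 := denq_gt0 r.
have hdvd (k : nat) : (denq r ^+ k %| M)%Z.
  have [n hn] := h k.
  have e : M * numq r ^+ k = n * denq r ^+ k.
    apply: (@intr_inj rat); rewrite !intrM !rmorphXn /= -hn -mulrA; congr (_ * _).
    by rewrite numqE exprMn.
  rewrite -(@Gauss_dvdzl _ _ (numq r ^+ k)); first by rewrite e dvdz_mull.
  by rewrite coprimezXl // coprimezXr // coprimez_sym; apply: coprime_num_den.
have hd1 : denq r = 1.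
  apply/eqP; rewrite eq_le -gtz0_ge1 d0 andbT leNgt; apply/negP => h2.
  have := hdvd `|M|%N; rewrite dvdzE abszX => /dvdn_leq.
  rewrite absz_gt0 gt_eqF // => /(_ isT); apply/negP; rewrite -ltnNge.
  by apply: ltn_expl; lia.
by exists (numq r); rewrite -[LHS]divq_num_den hd1 divr1.
Qed.

Lemma qnorm_pure a b (X Y : rat) (j k : quat) :
  qnorm a b (X *: (2 *: j - qtr j *: qone) + Y *: (2 *: k - qtr k *: qone)) =
  (4 * qnorm a b j - qtr j ^+ 2) * X ^+ 2 + (4 * qnorm a b k - qtr k ^+ 2) * Y ^+ 2
  + 2 * (qtr j * qtr k - 2 * qtr (qmul a b j k)) * X * Y.
Proof. qexpand; ring. Qed.

Section Order.
Variables (a b : int) (O : qset).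
Hypotheses (ha : a < 0) (hb : b < 0) (hO : is_order a b O).

Lemma order_denominator : exists2 M : int, 0 < M &
  forall x, O x -> forall n : nat, exists c : int, M%:~R * qc x n = c%:~R.
Proof.
have [[E [_ hE]] _] := hO; have [M hM [A hA]] := clear_denominators E.
exists M => // x /hE [u ->] n; exists ((u *m A) ord0 (inord n)).
have -> : ((u *m A) ord0 (inord n))%:~R = qc (map_mx intr (u *m A)) n by rewrite /qc !mxE.
by rewrite map_mxM -hA -scalemxAr qc_scale.
Qed.

(** The powers of [x] stay in [O], where coordinates have a common denominator [M]; so all powers of
    the norm have denominators dividing [M^2]. *)
Lemma order_norm_int x : O x -> exists n : int, qnorm a b x = n%:~R.
Proof.
move=> hx; have [M hM hc] := order_denominator; have [_ [h1 hm]] := hO.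
apply: (@bounded_denominators_int _ (M ^+ 2)); first by rewrite exprn_gt0.
pose y k := iter k (qmul a b x) qone.
have hy k : O (y k) by elim: k => //= k; apply: hm.
have ny k : qnorm a b (y k) = qnorm a b x ^+ k.
  by elim: k => [|k IH]; rewrite ?qnorm1 //= qnormM IH exprS.
move=> k; rewrite -ny.
have [c0 e0] := hc _ (hy k) 0; have [c1 e1] := hc _ (hy k) 1%N.
have [c2 e2] := hc _ (hy k) 2%N; have [c3 e3] := hc _ (hy k) 3%N.
exists (c0 ^+ 2 - a * c1 ^+ 2 - b * c2 ^+ 2 + a * b * c3 ^+ 2).
rewrite rmorphXn /= -qnormZ qnormE !qc_scale e0 e1 e2 e3; ring.
Qed.

Lemma order_closed x y : O x -> O y -> O (x + y).
Proof.
have [[E [_ hE]] _] := hO => /hE [u ->] /hE [v ->]; apply/hE; exists (u + v).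
by rewrite map_mxD mulmxDl.
Qed.

Lemma order_tr_int x : O x -> exists n : int, qtr x = n%:~R.
Proof.
move=> hx; have [_ [h1 _]] := hO.
have [n hn] := order_norm_int hx; have [m hm] := order_norm_int (order_closed hx h1).
exists (m - n - 1); move: hm; rewrite qnormD hn qnorm1 qmul1r qtr1 => hm.
by rewrite !rmorphB /= -hm; ring.
Qed.

(** 1 extends to a basis: it is [c] times a primitive vector of the lattice, and the norm [1/c^2] of
    that vector is an integer only for [c = 1] or [c = -1]. *)
Lemma order_basis : exists e1 e2 e3, (forall q, O q <-> zspan e1 e2 e3 q) /\
  (forall t x y z, lcomb e1 e2 e3 t x y z = 0 -> [/\ t = 0, x = 0, y = 0 & z = 0]).
Proof.
have [[E [hE hEO]] [h1 _]] := hO.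
have [u0 eu0] : lattice_of E qone by apply/hEO.
(* The Smith form of the single row [u0] makes it [c] times the first row of a unimodular [R]; the
   rows of [R] provide the new basis. *)
have [L _ [R hR [d _ eD]]] := int_Smith_normal_form u0.
set D := (X in L *m X *m R) in eD.
pose c : int := L ord0 ord0 * d`_0.
have ec : u0 = c *: row ord0 R.
  rewrite eD; have -> : L *m D = c *: delta_mx ord0 ord0.
    apply/matrixP => i j; rewrite !mxE big_ord1 !mxE !ord1.
    have -> : (ord0 == j :> nat) = (j == ord0) by rewrite eq_sym -val_eqE.
    by rewrite eqxx /c; case: (j == ord0); rewrite ?mulr1n ?mulr0n /=; ring.
  by rewrite -scalemxAl -rowE.
pose E2 : 'M[rat]_4 := map_mx intr R *m E.
have hE2 : E2 \in unitmx.
  by rewrite unitmx_mul hE andbT unitmxE det_map_mx rmorph_unit.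
pose e (n : nat) : quat := row (inord n) E2.
have lE2 (v : 'rV[rat]_4) : v *m E2 = v 0 (inord 0) *: e 0%N + v 0 (inord 1) *: e 1%N
    + v 0 (inord 2) *: e 2%N + v 0 (inord 3) *: e 3%N.
  rewrite mulmx_sum_row !big_ord_recl big_ord0 addr0 !addrA.
  have h (i : 'I_4) (n : nat) : i = n :> nat -> v 0 i *: row i E2 = v 0 (inord n) *: e n.
    by move=> <-; rewrite /e inord_val.
  by do ! congr (_ + _); apply: h.
have hOE2 q : O q <-> exists r : 'rV[int]_4, q = map_mx intr r *m E2.
  split=> [/hEO [v ->]|[r ->]].
    by exists (v *m invmx R); rewrite map_mxM /E2 mulmxA -[_ *m _ *m map_mx _ R]mulmxA
      -map_mxM mulVmx // map_mx1 mulmx1.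
  by apply/hEO; exists (r *m R); rewrite map_mxM /E2 mulmxA.
have e01 : c%:~R *: e 0%N = qone.
  rewrite eu0 ec map_mxZ -scalemxAl map_row -row_mul; congr (_ *: row _ _).
  by apply/val_inj; rewrite /= inordK.
have he0 : O (e 0%N).
  apply/hOE2; exists (delta_mx 0 (inord 0)).
  by rewrite map_delta_mx -rowE.
have cc : c = 1 \/ c = -1.
  have [n hn] := order_norm_int he0.
  have : c ^+ 2 * n = 1.
    by apply: (@intr_inj rat); rewrite intrM rmorphXn /= -hn -qnormZ e01 qnorm1.
  move=> h; have : (c %| c ^+ 2 * n)%Z by rewrite expr2 -mulrA dvdz_mulr.
  by rewrite h dvdz1; lia.
have c2 : c%:~R * c%:~R = 1 :> rat by case: cc => ->; ring.
have e0 : e 0%N = c%:~R *: qone by rewrite -e01 scalerA c2 scale1r.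
have lE2' (v : 'rV[rat]_4) : v *m E2 = lcomb (e 1%N) (e 2%N) (e 3%N)
    (v 0 (inord 0) * c%:~R) (v 0 (inord 1)) (v 0 (inord 2)) (v 0 (inord 3)).
  by rewrite lE2 e0 scalerA.
exists (e 1%N), (e 2%N), (e 3%N); split=> [q|t x y z h].
  rewrite hOE2; split=> [[r ->]|[t [x [y [z ->]]]]].
    by rewrite lE2' !mxE -intrM; do 4 eexists.
  exists (\row_(m < 4) nth 0 [:: t * c; x; y; z] m).
  by rewrite lE2' !mxE !inordK //= intrM -mulrA c2 mulr1.
have : (\row_(m < 4) nth 0 [:: t * c%:~R; x; y; z] m) *m E2 = 0.
  by rewrite lE2' !mxE !inordK //= -mulrA c2 mulr1.
move=> /(congr1 (mulmx^~ (invmx E2))); rewrite mulmxK // mul0mx => /rowP h0.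
move: (h0 (inord 0)) (h0 (inord 1)) (h0 (inord 2)) (h0 (inord 3)); rewrite !mxE !inordK //=.
move=> t0 -> -> ->; split => //.
by rewrite -[t]mulr1 -c2 mulrA t0 mul0r.
Qed.

(* If q1 q2 = r + A f with the basis 1, f, q1, q2 of O, then A divides N(q1), N(q2) and r:
   compare coefficients in conj(q1) (q1 q2) = N(q1) q2 and (q1 q2) conj(q2) = N(q2) q1. *)
Lemma exists_order_form : exists F, order_form a b O F.
Proof.
have [_ [h1 hm]] := hO.
have [e1 [e2 [e3 [hOe hfree]]]] := order_basis.
have [O1 O2 O3] := zspan_self e1 e2 e3.
have [r0 [al [be [ga eprod]]]] : zspan e1 e2 e3 (qmul a b e2 e3).
  by apply/hOe/hm; apply/hOe.
(* These translates remove [e2] and [e3] from the product of the two basis elements. *)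
pose j := e2 - ga%:~R *: qone; pose k := e3 - be%:~R *: qone.
have ejk : qmul a b j k = (r0 + be * ga)%:~R *: qone + al%:~R *: e1.
  by rewrite /j /k ?qmul_lin eprod; lring.
have [s [hs hA]] : exists s : int, s * s = 1 /\ 0 <= s * al.
  by case: (lerP 0 al) => h; [exists 1 | exists (-1)]; lia.
set A := s * al in hA; set r := r0 + be * ga in ejk; pose f := s%:~R *: e1.
have hs' : s%:~R * s%:~R = 1 :> rat by rewrite -intrM hs.
have {}ejk : qmul a b j k = r%:~R *: qone + A%:~R *: f.
  by rewrite ejk /f scalerA /A intrM -mulrA (mulrC al%:~R) mulrA hs' mul1r.
have free t x y z : lcomb f j k t x y z = 0 -> [/\ t = 0, x = 0, y = 0 & z = 0].
  move=> h.
  have := hfree (t - y * ga%:~R - z * be%:~R) (x * s%:~R) y z.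
  case; first by rewrite -h /f /j /k; lring.
  move=> t0 x0 y0 z0; split => //; first by rewrite -t0 y0 z0; ring.
  by rewrite -[x]mulr1 -hs' mulrA x0 mul0r.
have inj t x y z t' x' y' z' : lcomb f j k t x y z = lcomb f j k t' x' y' z' ->
    [/\ t = t', x = x', y = y' & z = z'].
  move=> h; have [|t0 x0 y0 z0] := free (t - t') (x - x') (y - y') (z - z').
    by rewrite -[RHS](subrr (lcomb f j k t' x' y' z')) -{1}h; lring.
  by split; apply/eqP; rewrite -subr_eq0; apply/eqP.
have hOf q : O q <-> zspan f j k q.
  rewrite hOe; split; apply: zspan_sub.
  - by exists 0, s, 0, 0; rewrite /lcomb /f scalerA hs'; lring.
  - by exists ga, 0, 1, 0; rewrite /j; lring.
  - by exists be, 0, 0, 1; rewrite /k; lring.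
  - by exists 0, s, 0, 0; rewrite /f; lring.
  - by exists (- ga), 0, 1, 0; rewrite /j; lring.
  - by exists (- be), 0, 0, 1; rewrite /k; lring.
clearbody f j k.
have [Sf Sj Sk] := zspan_self f j k.
have Of : O f by apply/hOf.
have Oj : O j by apply/hOf.
have Ok : O k by apply/hOf.
have [v hv] := order_tr_int Oj; have [w hw] := order_tr_int Ok.
have [tf htf] := order_tr_int Of.
have [nj hnj] := order_norm_int Oj; have [nk hnk] := order_norm_int Ok.
have [p0 [p1 [p2 [p3 hp]]]] : zspan f j k (qmul a b j f) by apply/hOf/hm.
have [q0 [q1 [q2 [q3 hq]]]] : zspan f j k (qmul a b f k) by apply/hOf/hm.
have E1 : lcomb f j k 0 0 0 nj%:~R = lcomb f j k (v * r - A * p0)%:~R (v * A - A * p1)%:~R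
    (- r - A * p2)%:~R (- (A * p3))%:~R.
  transitivity (qmul a b (qconj j) (qmul a b j k)).
    by rewrite qmulA qconj_mul qmulZl qmul1l hnj; lring.
  by rewrite ejk qconjE hv ?qmul_lin hp; lring.
have E2 : lcomb f j k 0 0 nk%:~R 0 = lcomb f j k (w * r - A * q0)%:~R (w * A - A * q1)%:~R
    (- (A * q2))%:~R (- r - A * q3)%:~R.
  transitivity (qmul a b (qmul a b j k) (qconj k)).
    by rewrite -qmulA qmul_conj qmulZr qmul1r hnk; lring.
  by rewrite ejk qconjE hw ?qmul_lin hq; lring.
have [_ _ /esym/eqP hr2 /intr_inj hnj3] := inj _ _ _ _ _ _ _ _ E1.
have [_ _ /intr_inj hnk2 _] := inj _ _ _ _ _ _ _ _ E2.
move: hr2; rewrite intr_eq0 => /eqP hr2.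
have j0 : j != 0.
  apply/eqP => j0; have [|_ _ /eqP] := free 0 0 1 0; first by rewrite -j0; lring.
  by rewrite oner_eq0.
have nj0 : 0 < nj by rewrite -(ltr0z rat) -hnj qnorm_gt0.
have A0 : 0 < A by rewrite lt_def hA andbT; apply/eqP => A0; move: nj0; rewrite hnj3 A0; lia.
have A0' : A%:~R != 0 :> rat by rewrite intr_eq0 gt_eqF.
(* Since [r = - A * p2], the product [j k] is [A] times [f - p2]; [i] is the conjugate of that
   element. *)
pose i := (tf - p2)%:~R *: qone - f.
have ei : A%:~R *: qconj i = qmul a b j k.
  rewrite ejk qconjE /i.
  have -> : qtr ((tf - p2)%:~R *: qone - f) = (tf - 2 * p2)%:~R.
    by rewrite qtrD qtrZ qtr1 -scaleN1r qtrZ htf; ring.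
  by rewrite (_ : r = - (A * p2)); [lring | lia].
have ei' : A%:~R *: i = qmul a b (qconj k) (qconj j).
  by rewrite -qconjM -ei qconjZ qconjK.
have can (x y : quat) : A%:~R *: x = A%:~R *: y -> x = y by move=> /(scalerI A0').
have hti : qtr i = (tf - 2 * p2)%:~R.
  by rewrite /i qtrD qtrZ qtr1 -scaleN1r qtrZ htf; ring.
set u := tf - 2 * p2 in hti.
have ni : qnorm a b i = (- q2 * - p3)%:~R.
  have A2 : A%:~R ^+ 2 != 0 :> rat by rewrite expf_eq0.
  apply: (mulfI A2); rewrite -qnormZ ei' qnormM !qnorm_conj hnj hnk hnj3 hnk2; ring.
have [_ Ij Ik] := zspan_self i j k.
exists (Form A (- q2) (- p3) u v w).
apply: (order_form_change (i' := i) (j' := j) (k' := k) hOf) => //.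
- split; rewrite /= ?hti ?hv ?hw ?ni ?hnj ?hnk //.
  + apply: can; rewrite -qmulZr ei' qmulA qmul_conj qmulZl qmul1l hnk hnk2.
    by rewrite !scalerA -intrM mulrN.
  + apply: can; rewrite -qmulZl ei' -qmulA qconj_mul qmulZr qmul1r hnj hnj3.
    by rewrite !scalerA -intrM mulrN.
  + by rewrite hnj3 mulrN.
  + by rewrite hnk2 mulrN.
  have trjk : qtr (qmul a b j k) = (A * u)%:~R by rewrite -ei qtrZ qtr_conj hti intrM.
  (* The right side is the norm of a nonzero combination of the pure quaternions [2 j - v] and
     [2 k - w]; this is [D] on the plane of the last two basis vectors. *)
  have key (X Y : int) : [|| X != 0 | Y != 0] ->
      0 < (4 * nj - v ^+ 2) * X ^+ 2 + (4 * nk - w ^+ 2) * Y ^+ 2 + 2 * (v * w - 2 * A * u) * X * Y.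
    move=> hXY; rewrite -(ltr0z rat).
    pose x := lcomb f j k (- (X * v + Y * w))%:~R 0 (2 * X)%:~R (2 * Y)%:~R.
    have x0 : x != 0.
      apply/eqP => /free[_ _ /eqP + /eqP]; rewrite !intr_eq0 => hX hY.
      by move: hXY hX hY; lia.
    rewrite (_ : _%:~R = qnorm a b x) ?qnorm_gt0 //.
    rewrite (_ : x = X%:~R *: (2 *: j - v%:~R *: qone) + Y%:~R *: (2 *: k - w%:~R *: qone));
      last by rewrite /x; lring.
    by rewrite -hv -hw qnorm_pure hnj hnk hv hw trjk; ring.
  split => //=.
  + by have := key 0 1 isT; rewrite /D3 /= hnk2; lia.
  + set F := Form _ _ _ _ _ _.
    have h3 : 0 < D3 F by have := key 0 1 isT; rewrite /D3 /= hnk2; lia.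
    have h2 : D2 F = 4 * nj - v ^+ 2 by rewrite /D2 /= hnj3; ring.
    have h3' : D3 F = 4 * nk - w ^+ 2 by rewrite /D3 /= hnk2; ring.
    have h23 : s23 F = v * w - 2 * A * u by [].
    (* At this vector a binary form takes the value [D3] times its determinant, which [minor23]
       turns into the discriminant. *)
    have := key (D3 F) (- s23 F) _; rewrite gt_eqF //= -h2 -h3' -h23 => /(_ isT).
    rewrite (_ : _ + _ = D3 F * (4 * disc F * fa F)); last by rewrite -minor23; ring.
    by rewrite pmulr_rgt0 // -mulrA pmulr_rgt0 // pmulr_lgt0.
- by exists (tf - p2), (-1), 0, 0; lring.
- by exists (tf - p2), (-1), 0, 0; rewrite /i; lring.
Qed.
End Order.

(** * Anisotropy at a prime and the discriminant of a maximal order *)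

Section Split.
Variables (a b : int) (O : qset) (l : nat).
Hypotheses (hO : is_order a b O) (hl : prime l).
Hypothesis haniso : forall x, O x -> (exists n : int, qnorm a b x = (l%:Z ^+ 2 * n)%:~R) ->
  exists2 y, O y & x = l%:~R *: y.

Lemma anisotropic_descent (m : nat) x : O x ->
  (exists n : int, qnorm a b x = (l%:Z ^+ (2 * m) * n)%:~R) ->
  exists2 y, O y & x = (l%:Z ^+ m)%:~R *: y.
Proof.
elim: m x => [|m IH] x hx [n hn]; first by exists x => //; rewrite expr0 scale1r.
have [|y hy ey] := haniso hx.
  by exists (l%:Z ^+ (2 * m) * n); rewrite hn; congr _%:~R; rewrite mulrA -exprD; congr (_ ^+ _ * _); lia.
have [|z hz ez] := IH y hy.
  exists n; apply: (@mulfI _ (l%:~R ^+ 2)).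
    by rewrite expf_eq0 /= intr_eq0; have := prime_gt0 hl; lia.
  rewrite -qnormZ -ey hn !intrM !rmorphXn /= mulrA -exprD; congr (_ ^+ _ * _); lia.
by exists z => //; rewrite ey ez scalerA -intrM -exprS.
Qed.

Lemma anisotropic_not_split : ~ splits_at l a b.
Proof.
move=> hsplit; have [[E [hE hEO]] _] := hO.
have [M hM [A hA]] := clear_denominators E.
have [N hN [B hB]] := clear_denominators (invmx E).
(* Descent makes [l^m] divide [M * N] times every coordinate of [x]. One coordinate is prime to [l],
   so [l^m] would divide [M * N], which is impossible as [m < l^m]. *)
pose m := absz (M * N).
have [X [Y [Z [hprim hdvd]]]] := hsplit (2 * m)%N.
pose v : 'rV[int]_4 := \row_(n < 4) nth 0 [:: Z; X; Y; 0] n.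
pose x : quat := map_mx intr v.
have ev n : (n < 4)%N -> qc x n = (nth 0 [:: Z; X; Y; 0] n)%:~R.
  by move=> hn; rewrite /qc !mxE inordK.
have hx : O (N%:~R *: x).
  apply/hEO; exists (v *m B).
  by rewrite map_mxM -hB -scalemxAr -scalemxAl mulmxKV.
have [|y hy ey] := anisotropic_descent (m := m) hx.
  move/dvdzP: hdvd => [q hq]; exists (- (N ^+ 2 * q)).
  rewrite qnormZ qnormE !ev //= (_ : _ * (- _) = - (N ^+ 2 * (q * l%:Z ^+ (2 * m)))); last by ring.
  by rewrite -hq; ring.
move/hEO: hy => [u eu].
have key n : (n < 4)%N -> (l%:Z ^+ m %| M * N * nth 0%R [:: Z; X; Y; 0] n)%Z.
  move=> hn; apply/dvdzP; exists ((u *m A) ord0 (inord n)); apply: (@intr_inj rat).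
  have -> : (M * N * nth 0%R [:: Z; X; Y; 0] n)%:~R = qc (M%:~R *: (N%:~R *: x)) n.
    by rewrite !qc_scale ev // !intrM mulrA.
  rewrite ey eu scalerA mulrC -scalerA scalemxAr hA -map_mxM qc_scale intrM mulrC.
  by congr (_ * _); rewrite /qc [LHS]mxE.
have hlt : (m < l ^ m)%N by apply: ltn_expl; apply: prime_gt1.
have hMN : 0 < M * N by rewrite mulr_gt0.
have no n : (n < 4)%N -> ~~ (l%:Z %| nth 0%R [:: Z; X; Y; 0] n)%Z -> False.
  move=> hn h; have := key n hn; rewrite Gauss_dvdzl; last first.
    by rewrite coprimezXl // coprimezE /= prime_coprime // -dvdzE.
  rewrite dvdzE abszX => /dvdn_leq; rewrite absz_gt0 gt_eqF // => /(_ isT).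
  by rewrite leqNgt hlt.
move: hprim; rewrite !negb_and => /or3P[] h.
- exact: (no 1%N _ h).
- exact: (no 2%N _ h).
- exact: (no 0%N _ h).
Qed.

End Split.

Section MaximalDisc.
Variables (p : nat) (a b : int) (O : qset).
Hypotheses (hp : prime p) (hram : ramified_exactly_at_p_infty p a b).
Hypothesis hmax : is_maximal_order a b O.

Lemma maximal_disc_prime (l : nat) F : prime l -> order_form a b O F ->
  (l%:Z %| disc F)%Z -> l = p /\ ~~ (l%:Z ^+ 2 %| disc F)%Z.
Proof.
move=> hl hF hdvd; have l1 := prime_gt1 hl.
have hst : stable (fun G => order_form a b O G /\ disc G = disc F).
  have [h1 h2 h3 h4] := order_form_stable a b O.
  split=> [G [hG <-]|G [hG <-]|G [hG <-]|m G [hG <-]];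
    (split; [by [apply: h1|apply: h2|apply: h3|apply: h4] | by fring]).
have [|||G [hG eG] han] := @exists_anisotropic l (disc F) _ hl hst _ _ _ hdvd F (conj hF erefl).
- by move=> G [].
- by move=> G [hG _]; apply: maximal_noA hmax l1 hG.
- by move=> G [hG _]; apply: maximal_noB hmax l1 hG.
rewrite -eG; split; last exact: anisotropic_disc.
have [_ [_ [_ hr]]] := hram; apply/hr => //.
have [i [j [k [hB hO]]]] := hG.
have [ho _] := hmax.
apply: (anisotropic_not_split ho hl) => x /hO [t [x1 [x2 [x3 ->]]]] [n].
rewrite (qnorm_lcomb _ _ _ _ hB) => /intr_inj hn.
have [|] := @anisotropic_normf l G t x1 x2 x3 hl han; first by rewrite hn dvdz_mulr.
move=> /dvdzP[t' ->] /dvdzP[x1' ->] /dvdzP[x2' ->] /dvdzP[x3' ->].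
exists (lcomb i j k t'%:~R x1'%:~R x2'%:~R x3'%:~R); first by apply/hO; do 4 eexists.
lring.
Qed.

Lemma maximal_disc F : order_form a b O F -> reduced F -> disc F = p%:Z.
Proof.
move=> hF hR; have hpos := order_form_posdef hF.
have h1 := red_disc_gt1 hpos hR.
have hn (n : nat) : (1 < n)%N -> (n%:Z %| disc F)%Z -> (p %| n)%N.
  move=> hn hd; have hl := pdiv_prime hn.
  have [|<- _] := maximal_disc_prime hl hF; last exact: pdiv_dvd.
  by apply: dvdz_trans hd; rewrite dvdzE pdiv_dvd.
have hpd : (p%:Z %| disc F)%Z.
  have := hn `|disc F|%N; rewrite !dvdzE => h; apply: h => //; lia.
have [_ hsq] := maximal_disc_prime hp hF hpd.
have [e he] := dvdzP hpd.
have p0 : 0 < p%:Z by have := prime_gt0 hp; lia.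
have e0 : 0 < e by move: h1 p0; rewrite he; clear; nia.
case: (eqVneq e 1) => [e1|ne]; first by rewrite he e1 mul1r.
exfalso; move/negP: hsq; apply.
have : (p %| `|e|)%N.
  by apply: hn; [lia | rewrite he dvdzE abszM dvdn_mulr].
by rewrite he expr2 => h; rewrite dvdz_mul // dvdzE.
Qed.

End MaximalDisc.

(** * Theta series *)

Definition ivec := (int * int * int)%type.
Definition Df F (v : ivec) := Dv F v.1.1 v.1.2 v.2.
Definition ivecN (v : ivec) : ivec := (- v.1.1, - v.1.2, - v.2).

Definition ints (B : nat) : seq int := [seq m%:Z - B%:Z | m <- iota 0 (2 * B).+1].

Lemma mem_ints B (x : int) : (x \in ints B) = (`|x| <= B%:Z).
Proof.
apply/mapP/idP => [[m]|h]; first by rewrite mem_iota => hm ->; lia.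
by exists (absz (x + B%:Z)); rewrite ?mem_iota; lia.
Qed.

Lemma uniq_ints B : uniq (ints B).
Proof. by rewrite map_inj_uniq ?iota_uniq // => m n; lia. Qed.

Definition box (B : nat) : seq ivec :=
  [seq (xy, z) | xy <- [seq (x, y) | x <- ints B, y <- ints B], z <- ints B].

Lemma mem_box B v : (v \in box B) = [&& `|v.1.1| <= B%:Z, `|v.1.2| <= B%:Z & `|v.2| <= B%:Z].
Proof.
case: v => [[x y] z] /=; rewrite -!mem_ints andbA.
apply/idP/andP => [/allpairsPdep[xy [z' [hxy hz [exy ->]]]]|[/andP[hx hy] hz]].
  by move: hxy; rewrite -exy => /allpairsPdep[x' [y' [hx hy [-> ->]]]]; rewrite hx hy.
apply/allpairsPdep; exists (x, y), z; split => //.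
by apply/allpairsPdep; exists x, y.
Qed.

Lemma uniq_box B : uniq (box B).
Proof.
apply: allpairs_uniq; rewrite ?uniq_ints //; last by move=> [? ?] [? ?] _ _ [-> ->].
by apply: allpairs_uniq; rewrite ?uniq_ints // => [[? ?] [? ?] _ _ [-> ->]].
Qed.

Definition cnt F B (M : int) : nat := count (fun v => Df F v == M) (box B).

Definition large_box F (B N : nat) :=
  forall v, Df F v <= 4 * N%:Z -> v \in box B.

Lemma Df_coord_le F v : posdef F -> [/\ `|v.1.1| <= fa F * Df F v,
  `|v.1.2| <= fb F * Df F v & `|v.2| <= fc F * Df F v].
Proof.
move=> hF; case: v => [[x y] z] /=; rewrite /Df /=.
have hF1 : posdef (rot F).
  have [? ? ? [? ? ? ?]] := posdef_all hF; split => //.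
  by rewrite (_ : disc _ = disc F) //; fring.
have hF2 : posdef (rot (rot F)).
  have [? ? ? [? ? ? ?]] := posdef_all hF; split => //.
    by rewrite (_ : D3 _ = D2 F) //; fring.
  by rewrite (_ : disc _ = disc F) //; fring.
have e1 : Dv (rot F) y z x = Dv F x y z by fring.
have e2 : Dv (rot (rot F)) z x y = Dv F x y z by fring.
have h0 := Dv_bound x y z hF.
have h1 := Dv_bound y z x hF1; have h2 := Dv_bound z x y hF2.
rewrite e1 /= in h1; rewrite e2 /= in h2.
have key (t K : int) : t ^+ 2 <= K -> `|t| <= K by case: (lerP 0 t); nia.
by split; apply: key.
Qed.

Lemma exists_large_box F G N : posdef F -> posdef G ->
  exists B, [/\ large_box F B N, large_box G B N & (4 * N <= B)%N].
Proof.
move=> hF hG; have [fa0 fb0 fc0 _] := posdef_all hF; have [ga0 gb0 gc0 _] := posdef_all hG.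
exists (absz (4 * N%:Z * (1 + fa F + fb F + fc F + fa G + fb G + fc G))).
have aux H (v : ivec) (K : int) : posdef H -> fa H <= K -> fb H <= K -> fc H <= K ->
    Df H v <= 4 * N%:Z -> v \in box (absz (4 * N%:Z * K)).
  move=> hH ka kb kc hv; have [a0 b0 c0 _] := posdef_all hH.
  have [h1 h2 h3] := Df_coord_le v hH; have d0 : 0 <= Df H v by apply: Dv_ge0.
  have hm (c : int) : 0 < c -> c <= K -> c * Df H v <= 4 * N%:Z * K.
    by move=> c1 c2; rewrite mulrC; apply: ler_pM => //; lia.
  have e : (absz (4 * N%:Z * K))%:Z = 4 * N%:Z * K by rewrite gez0_abs // mulr_ge0; lia.
  rewrite mem_box e.
  by rewrite (le_trans h1 (hm _ a0 ka)) (le_trans h2 (hm _ b0 kb)) (le_trans h3 (hm _ c0 kc)).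
split.
- by move=> v; apply: aux => //; lia.
- by move=> v; apply: aux => //; lia.
- by nia.
Qed.

(** [s.1] stands for the trace of an order element and [s.2] for its coordinates on [i], [j], [k].
    The parity of the trace is not imposed: it follows from [D] modulo 4. *)
Definition sols F (n : nat) (s : int * ivec) := s.1 ^+ 2 + Df F s.2 == 4 * n%:Z.

Definition slist F B (n : nat) : seq (int * ivec) :=
  [seq (t, v) | t <- ints B, v <- [seq v <- box B | Df F v == 4 * n%:Z - t ^+ 2]].

Lemma size_slist F B n : size (slist F B n) = (\sum_(t <- ints B) cnt F B (4 * n%:Z - t ^+ 2)%R)%N.
Proof.
rewrite size_allpairs_dep sumnE big_map; apply: eq_bigr => t _.
by rewrite size_filter.
Qed.

Lemma uniq_slist F B n : uniq (slist F B n).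
Proof.
apply: allpairs_uniq_dep; first exact: uniq_ints.
  by move=> t _; rewrite filter_uniq ?uniq_box.
by move=> [? ?] [? ?] _ _ /= [-> ->].
Qed.

Lemma slist_sols F B n s : s \in slist F B n -> sols F n s.
Proof.
move=> /allpairsPdep[t [v [_ + ->]]]; rewrite mem_filter /sols /= => /andP[/eqP -> _].
by apply/eqP; ring.
Qed.

Lemma sols_slist F B n N s : posdef F -> large_box F B N -> (4 * N <= B)%N -> (n <= N)%N ->
  sols F n s -> s \in slist F B n.
Proof.
case: s => t v hF hB hNB hnN; rewrite /sols /= => /eqP h.
have d0 : 0 <= Df F v by apply: Dv_ge0.
have t0 := sqr_ge0 t.
apply/allpairsPdep; exists t, v; split => //.
  rewrite mem_ints.
  have : t ^+ 2 <= B%:Z by lia.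
  by move: t0; clear; case: (lerP 0 t); nia.
rewrite mem_filter; apply/andP; split; first by apply/eqP; lia.
by apply: hB; lia.
Qed.

Lemma order_sols a b i j k F (n : nat) (t : int) v : clifford_basis a b i j k F ->
  sols F n (t, v) -> exists2 m : int, t = 2 * m + fu F * v.1.1 + fv F * v.1.2 + fw F * v.2 &
    qnorm a b (lcomb i j k m%:~R v.1.1%:~R v.1.2%:~R v.2%:~R) = n%:R.
Proof.
case: v => [[x y] z] hB; rewrite /sols /Df /= => /eqP h.
have [q hq] := Dv_mod4 F x y z; rewrite hq in h.
have [m hm] := @congr_sq_mod4 t (fu F * x + fv F * y + fw F * z) n%:Z q ltac:(lia).
exists m; first by rewrite hm; ring.
apply: (@mulfI _ 4) => //; rewrite (lcomb_norm_int hB) hq.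
have -> : n%:R = n%:Z%:~R :> rat by rewrite pmulrn.
by rewrite (_ : 4 * n%:Z%:~R = (4 * n%:Z)%:~R); [congr _%:~R; rewrite -h hm | ]; ring.
Qed.

Lemma theta_le a b O O' F G B N (n : nat) : order_form a b O F -> order_form a b O' G ->
  same_theta a b O O' -> large_box G B N -> (4 * N <= B)%N -> (n <= N)%N ->
  (size (slist F B n) <= size (slist G B n))%N.
Proof.
move=> [i [j [k [hB hO]]]] [i' [j' [k' [hB' hO']]]] hth hbox hNB hnN.
have [f /bij_inj finj] := hth n.
pose lc (s : int * ivec) (m : int) :=
  lcomb i j k m%:~R s.2.1.1%:~R s.2.1.2%:~R s.2.2%:~R.
pose rel (s s' : int * ivec) := exists m pr m' , 
  [/\ s.1 = 2 * m + fu F * s.2.1.1 + fv F * s.2.1.2 + fw F * s.2.2,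
      s'.1 = 2 * m' + fu G * s'.2.1.1 + fv G * s'.2.1.2 + fw G * s'.2.2 &
      sval (f (exist _ (lc s m) pr)) =
        lcomb i' j' k' m'%:~R s'.2.1.1%:~R s'.2.1.2%:~R s'.2.2%:~R].
(* The implication stands under the quantifier, with [s] as default value, so that choice defines
   [g] on all pairs. *)
have hrel s : exists s', sols F n s -> sols G n s' /\ rel s s'.
  case: (boolP (sols F n s)) => hs; last by exists s.
  move: (hs); rewrite {1}(surjective_pairing s) => /(order_sols hB)[m em hm].
  have pr : O (lc s m) /\ qnorm a b (lc s m) = n%:R.
    by split => //; apply/hO; do 4 eexists.
  have [/hO' [m' [x [y [z e]]]] hn] := svalP (f (exist _ (lc s m) pr)).
  exists (2 * m' + fu G * x + fv G * y + fw G * z, (x, y, z)) => _; split; last by exists m, pr, m'.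
  rewrite /sols /Df /=; apply/eqP/(@intr_inj rat).
  rewrite -(lcomb_norm_int hB') -e hn [n%:R]pmulrn; ring.
pose g s := sval (constructive_indefinite_description _ (hrel s)).
have hg s : sols F n s -> sols G n (g s) /\ rel s (g s).
  exact: (svalP (constructive_indefinite_description _ (hrel s))).
have ginj : {in slist F B n &, injective g}.
  move=> s1 s2 /slist_sols/hg[_ [m1 [pr1 [m1' [e1 e1' h1]]]]] /slist_sols/hg[_ [m2 [pr2 [m2' [e2 e2' h2]]]]] eg.
  rewrite eg in h1 e1'.
  have em' : m1' = m2' by lia.
  have {}em' : f (exist _ (lc s1 m1) pr1) = f (exist _ (lc s2 m2) pr2).
    by apply: eq_sig_hprop => [? ? ?|]; [apply: proof_irrelevance | rewrite /= h1 h2 em'].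
  move/finj/(congr1 sval): em' => /= /(lcomb_inj hB)[] /intr_inj em /intr_inj ex /intr_inj ey /intr_inj ez.
  case: s1 s2 e1 e2 ex ey ez {eg h1 h2 pr1 pr2 e1' e2'} => [t1 [[x1 y1] z1]] [t2 [[x2 y2] z2]] /=.
  by move=> -> -> <- <- <-; rewrite em.
rewrite -(size_map g); apply: uniq_leq_size; first by rewrite map_inj_in_uniq ?uniq_slist.
move=> s' /mapP[s /slist_sols/hg[hs _] ->].
by apply: (sols_slist (cb_pos hB') hbox hNB hnN).
Qed.

Lemma cnt_neg F B M : posdef F -> M < 0 -> cnt F B M = 0%N.
Proof.
move=> hF hM; apply/eqP; rewrite -leqn0 leqNgt -has_count; apply/hasPn => v _.
by have : 0 <= Df F v by [apply: Dv_ge0]; lia.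
Qed.

Lemma cnt0 F B : posdef F -> cnt F B 0 = 1%N.
Proof.
move=> hF; rewrite /cnt (eq_count (a2 := pred1 ((0, 0, 0) : ivec))).
  by rewrite count_uniq_mem ?uniq_box // mem_box.
move=> [[x y] z]; rewrite /Df /=; apply/eqP/eqP => [/(Dv_eq0 hF)[-> -> ->]|[-> -> ->]] //.
by rewrite /Dv; ring.
Qed.

Lemma cnt_pos F B (M : int) : cnt F B M <> 0%N -> rep F M.
Proof.
move=> /eqP; rewrite -lt0n -has_count => /hasP[[[x y] z] _ /eqP e].
by exists x, y, z.
Qed.

Lemma cnt_rep F B N (p : nat) (M : int) : prime p -> posdef F -> disc F = p%:Z ->
  large_box F B N -> 0 < M -> M <= p%:Z -> M <= 4 * N%:Z -> rep F M -> cnt F B M = 2%N.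
Proof.
move=> hp hF hd hB hM hMp hMN [x [y [z e]]].
pose v : ivec := (x, y, z).
have ev : Df F v = M by [].
have eN : Df F (ivecN v) = M by rewrite -ev; apply: DvN.
have hv : v != ivecN v.
  apply/eqP => -[hx hy hz]; have [x0 y0 z0] : [/\ x = 0, y = 0 & z = 0] by split; lia.
  by move: e hM; rewrite x0 y0 z0 /Dv; lia.
rewrite /cnt -size_filter; have -> : 2%N = size [:: v; ivecN v] by [].
apply/perm_size/uniq_perm; first by rewrite filter_uniq ?uniq_box.
  by rewrite /= inE hv.
move=> [[x' y'] z']; rewrite mem_filter !inE; apply/andP/orP => [[/eqP h _]|].
  have [] := @Dv_distinct F p x' y' z' x y z hF hd hp; rewrite ?e //.
  - by move: hMp; rewrite -h.
  - by move=> ->; left.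
  - by move=> ->; right.
by case=> /eqP ->; split; rewrite ?ev ?eN //; apply: hB; rewrite ?ev ?eN.
Qed.

(** Isolates the terms [t = 0, 1, -1], the only ones for which [4 n - t^2] exceeds [4 (n - 1)]. *)
Lemma sum_ints (H : int -> nat) B : (0 < B)%N ->
  (\sum_(t <- ints B) H t = H 0%R + H 1%R + H (-1)%R + \sum_(t <- ints B | (1 < t ^+ 2)%R) H t)%N.
Proof.
move=> hB; rewrite (bigID (fun t : int => 1 < t ^+ 2)) /= addnC; congr (_ + _)%N.
rewrite -big_filter (perm_big [:: 0; 1; -1]).
  by rewrite unlock /= addn0 !addnA.
apply: uniq_perm; rewrite ?filter_uniq ?uniq_ints // => t.
rewrite mem_filter mem_ints !inE -leNgt; apply/andP/or3P.
  move=> [h _]; have : [|| t == 0, t == 1 | t == -1] by move: h; clear; nia.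
  by move/or3P.
by case=> /eqP ->; split; lia.
Qed.

Lemma same_theta_sym a b O O' : same_theta a b O O' -> same_theta a b O' O.
Proof. by move=> h n; have [f [g fg gf]] := h n; exists g, f. Qed.

(* For M = 4n and 4n - 1 both at most p, each count is 0 or 2, so the known total
   cnt(4n) + 2 cnt(4n - 1) determines them both. *)
Lemma same_theta_rep (p : nat) a b O O' F G : prime p ->
  order_form a b O F -> order_form a b O' G -> disc F = p%:Z -> disc G = p%:Z ->
  same_theta a b O O' -> rep_sub p F G.
Proof.
move=> hp hOF hOG dF dG hth.
have hF := order_form_posdef hOF; have hG := order_form_posdef hOG.
have [B [bF bG hB]] := exists_large_box p hF hG.
have p1 := prime_gt1 hp.
have cF (M : int) : 0 < M -> M <= p%:Z -> cnt F B M = 0%N \/ cnt F B M = 2%N.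
  move=> h1 h2; case: (eqVneq (cnt F B M) 0%N) => [|/eqP h]; [by left | right].
  by apply: (cnt_rep hp hF dF bF h1 h2); [lia | apply: cnt_pos h].
have cG (M : int) : 0 < M -> M <= p%:Z -> cnt G B M = 0%N \/ cnt G B M = 2%N.
  move=> h1 h2; case: (eqVneq (cnt G B M) 0%N) => [|/eqP h]; [by left | right].
  by apply: (cnt_rep hp hG dG bG h1 h2); [lia | apply: cnt_pos h].
have cmod H (M q : int) : (M = 4 * q + 1 \/ M = 4 * q + 2) -> cnt H B M = 0%N.
  move=> hM; case: (eqVneq (cnt H B M) 0%N) => // /eqP/cnt_pos[x [y [z e]]].
  by have [r hr] := Dv_mod4_cases H x y z; rewrite e in hr; lia.
have main (n : nat) : (4 * n <= p)%N -> forall M : int, M <= 4 * n%:Z -> cnt F B M = cnt G B M.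
  elim: n => [_ M hM|n IH hn M hM].
    case: (ltrP M 0) => h0; first by rewrite !cnt_neg.
    by rewrite (_ : M = 0) ?cnt0 //; lia.
  have {}IH := IH ltac:(lia).
  case: (lerP M (4 * n%:Z)) => hMn; first exact: IH.
  have [hM1|hM2] : (M = 4 * n%:Z + 1 \/ M = 4 * n%:Z + 2) \/
      (M = 4 * n.+1%:Z \/ M = 4 * n.+1%:Z - 1) by lia.
    by rewrite (cmod F M n%:Z hM1) (cmod G M n%:Z hM1).
  have e : size (slist F B n.+1) = size (slist G B n.+1).
    apply/eqP; rewrite eqn_leq.
    rewrite (theta_le hOF hOG hth bG hB) ?(theta_le hOG hOF (same_theta_sym hth) bF hB) //; lia.
  rewrite !size_slist !sum_ints in e; try lia.
  have er : (\sum_(t <- ints B | (1 < t ^+ 2)%R) cnt F B (4 * n.+1%:Z - t ^+ 2)%R =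
    \sum_(t <- ints B | (1 < t ^+ 2)%R) cnt G B (4 * n.+1%:Z - t ^+ 2)%R)%N.
    (* No square is 2 or 3, but it is simpler to note that these values would lead to arguments 2
       and 1 modulo 4, where both counts vanish. *)
    apply: eq_bigr => t ht; case: (eqVneq (t ^+ 2) 2) => t2.
      by rewrite (cmod F _ n%:Z) ?(cmod G _ n%:Z) //; lia.
    case: (eqVneq (t ^+ 2) 3) => t3.
      by rewrite (cmod F _ n%:Z) ?(cmod G _ n%:Z) //; lia.
    by apply: IH; lia.
  rewrite er in e; move/addIn: e.
  rewrite expr0n subr0 sqrrN expr1n.
  have f0 := cF (4 * n.+1%:Z) ltac:(lia) ltac:(lia).
  have f1 := cF (4 * n.+1%:Z - 1) ltac:(lia) ltac:(lia).
  have g0 := cG (4 * n.+1%:Z) ltac:(lia) ltac:(lia).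
  have g1 := cG (4 * n.+1%:Z - 1) ltac:(lia) ltac:(lia).
  by case: hM2 => ->; case: f0 => ->; case: f1 => ->; case: g0 => ->; case: g1 => ->.
move=> M hM hMp [x [y [z e]]]; apply: (@cnt_pos _ B).
have [q hq] := Dv_mod4_cases F x y z; rewrite e in hq.
(* For [M = 4 q + 3] the strict inequality [M < p] leaves room for [4 (q + 1) <= p]. *)
pose n : nat := if M == 4 * q then absz q else (absz q).+1.
have hn : (4 * n <= p)%N /\ M <= 4 * n%:Z by rewrite /n; case: eqP => h; lia.
rewrite -(main n hn.1 _ hn.2) (cnt_rep hp hF dF bF) //; [lia | lia | by exists x, y, z].
Qed.

Theorem theorem1p2 (p : nat) (a b : int) (O O' : qset) :
  prime p ->
  ramified_exactly_at_p_infty p a b ->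
  is_maximal_order a b O -> is_maximal_order a b O' ->
  same_theta a b O O' ->
  ring_isomorphic a b O O'.
Proof.
move=> hp hram hO hO' hth.
have [_ [_ [[ha hb] _]]] := hram.
have red Q : is_maximal_order a b Q ->
    exists2 F, order_form a b Q F & prime_reduced p F.
  move=> hQ; have [F0 hF0] := exists_order_form ha hb hQ.1.
  have [F hF hR] := exists_reduced (order_form_stable a b Q) hF0 (@order_form_posdef a b Q).
  exists F => //; split => //; first exact: order_form_posdef hF.
  exact: maximal_disc hram hQ _ hF hR.
have [F hF pF] := red _ hO; have [G hG pG] := red _ hO'.
apply: (order_form_iso hF).
(* The stable predicate is being a form of [O']: it holds for [G], hence for [F], which is then a
   form of both orders. *)
apply: (stable_rep pF pG _ _ (order_form_stable a b O') hG).
- by apply: same_theta_rep hp hF hG (pr_disc pF) (pr_disc pG) hth.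
- by apply: same_theta_rep hp hG hF (pr_disc pG) (pr_disc pF) (same_theta_sym hth).
Qed.
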